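(* Let $h$ be a given real-valued function of $(X,\theta)$ and let $T=E_{G^*}h(X,\theta)=\sum_{l,k}h(x_l,s_k)\,g_{lk}$, where $g_{lk}=P_{G^*}(X=x_l,\theta=s_k)$. Let $$T_U=\max_{\gamma}\sum_{l,k}h(x_l,s_k)\gamma_{lk},\qquad T_L=\min_{\gamma}\sum_{l,k}h(x_l,s_k)\gamma_{lk},$$ where both optimizations are over vectors $\gamma=(\gamma_{lk})_{1\le l\le L,\,1\le k\le K}$ subject to $$n\,(\hat f^*-P^*\gamma)'\,\hat\Sigma^{*-1}(\hat f^*-P^*\gamma)<\chi^2_{(Q-1),1-\alpha},\qquad 0\le\gamma_{lk}\le1\ \text{for all } l,k,\qquad \sum_{l,k}\gamma_{lk}=1.$$ If $\Sigma^*$ is non-singular, then $(T_L,T_U)$ is a $(1-\alpha)$ level confidence interval for $T$, asymptotically as $n\to\infty$.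
   Context: $(X_i,Y_i,\theta_i)$, $i=1,\dots,n$, are i.i.d. random vectors distributed like $(X,Y,\theta)\sim G^*$. The variables are discrete with finite supports: $X\in\{x_1,\dots,x_L\}$, $Y\in\{y_1,\dots,y_J\}$, $\theta\in\{s_1,\dots,s_K\}$. Only $\mathcal T(X_i,Y_i)$, $i=1,\dots,n$, are observed, for some given function $\mathcal T$; $t_1,\dots,t_Q$ are the distinct values of $\mathcal T(x_l,y_j)$, $l=1,\dots,L$, $j=1,\dots,J$. The joint distribution of $(X,\theta)$, given by $g=(g_{lk})$ with $g_{lk}=P_{G^*}(X=x_l,\theta=s_k)$, is unknown, while the conditional distribution of $\mathcal T=\mathcal T(X,Y)$ given $(X,\theta)$ is known. $P$ is the known $Q\times(LK)$ matrix whose entry in row $j$ and in the column indexed by the pair $(l,k)$ is $P(\mathcal T=t_j\mid X=x_l,\theta=s_k)$, so that $f=(f_1,\dots,f_Q)'$ with $f_j=P(\mathcal T(X,Y)=t_j)$ satisfies $f=Pg$. $P^*$ is the matrix obtained from $P$ by deleting its last row. $\hat f_j$ is the proportion of indices $i\in\{1,\dots,n\}$ with $\mathcal T(X_i,Y_i)=t_j$, and $\hat f^*=(\hat f_1,\dots,\hat f_{Q-1})'$, whose mean is $P^*g$. The covariance matrix of $\hat f^*$ is $\Sigma^*/n$ (so $\Sigma^*$ is the multinomial covariance matrix $\mathrm{diag}(f^* )-f^*f^{*\prime}$ with $f^*=(f_1,\dots,f_{Q-1})'$), and $\hat\Sigma^*$ is the empirical version of $\Sigma^*$ (the empirical covariance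 matrix). $\chi^2_{(Q-1),1-\alpha}$ is the critical value of the $\alpha$-level $\chi^2$ test with $Q-1$ degrees of freedom, i.e. the $(1-\alpha)$-quantile of the chi-square distribution with $Q-1$ degrees of freedom. A prime denotes transpose.
   Formalization: The interval is taken closed, T_L ≤ T ≤ T_U (the open one fails, e.g. for constant h), max and min over the strict constraint are read as supremum and infimum, and Q ≥ 2 is assumed. *)

(* Defs.v *)
From HB Require Import structures.
From mathcomp Require Import all_boot all_order all_algebra.
From mathcomp Require Import all_classical all_reals all_analysis.
From mathcomp Require Import measurable_realfun.

Set Implicit Arguments.
Unset Strict Implicit.
Unset Printing Implicit Defensive.

Import Order.TTheory GRing.Theory Num.Theory.
Import numFieldNormedType.Exports.

Local Open Scope classical_set_scope.
Local Open Scope ring_scope.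

Definition add_sqr (R : realType)
    (z : measurableTypeR R * measurableTypeR R) : measurableTypeR R :=
  z.1 + z.2 ^+ 2.

Lemma measurable_add_sqr (R : realType) : measurable_fun setT (@add_sqr R).
Proof.
apply: measurable_funD; first exact: measurable_fst.
by apply: measurable_funX; exact: measurable_snd.
Qed.

HB.instance Definition _ (R : realType) :=
  isMeasurableFun.Build _ _ _ _ (@add_sqr R) (@measurable_add_sqr R).

(* The law of Z_1^2 + ... + Z_k^2 for Z_1, ..., Z_k independent and standard
   normal; normal_prob takes the mean and the standard deviation. *)
Fixpoint chi2 (R : realType) (k : nat) : probability (measurableTypeR R) R :=
  if k is k'.+1 then
    distribution (chi2 R k' \x normal_prob (0 : R) 1)%E (@add_sqr R)
  else \d_(0 : measurableTypeR R).

(* Generalized inverse of the distribution function, for 0 < p < 1. *)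
Definition quantile (R : realType) (mu : probability (measurableTypeR R) R)
    (p : R) : R :=
  inf [set r : R | (p%:E <= mu [set` `]-oo, r]])%E].

(* Random element of a discrete space V, with values in S. *)
Definition discrete_rv d (Om : measurableType d) (V : Type) (S : set V)
    (Z : Om -> V) : Prop :=
  (forall w, S (Z w)) /\ (forall A : set V, measurable (Z @^-1` A)).

(* The sequence Zs is i.i.d. and each Zs i is distributed like Z. All sets A
   are admitted: the definition is meant for discrete random elements. *)
Definition iid_copies d (Om : measurableType d) (R : realType)
    (Pr : probability Om R) (V : Type) (Z : Om -> V) (Zs : nat -> Om -> V) :
    Prop :=
  (forall i (A : set V), Pr (Zs i @^-1` A) = Pr (Z @^-1` A)) /\
  (forall (I : seq nat) (A : nat -> set V), uniq I ->
     Pr (\bigcap_(i in [set` I]) (Zs i @^-1` A i)) =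
     (\prod_(i <- I) Pr (Zs i @^-1` A i))%E).

Definition joint_pmf d (Om : measurableType d) (R : realType)
    (Pr : probability Om R) (XT ThT : Type) (L K : nat)
    (x : 'I_L -> XT) (s : 'I_K -> ThT) (X : Om -> XT) (theta : Om -> ThT) :
    'M[R]_(L, K) :=
  \matrix_(l, k) fine (Pr [set w | X w = x l /\ theta w = s k]).

Definition pmf_vec d (Om : measurableType d) (R : realType)
    (Pr : probability Om R) (TT : Type) (Q : nat) (t : 'I_Q -> TT)
    (T : Om -> TT) : 'cV[R]_Q :=
  \col_j fine (Pr [set w | T w = t j]).

(* P is (a version of) the conditional distribution of T given (X, theta).
   The column of the pair (l, k) has index mxvec_index l k, so that P applies
   to g through mxvec. When P(X = x_l, theta = s_k) = 0 the column may be any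
   probability vector. *)
Definition is_cond_dist d (Om : measurableType d) (R : realType)
    (Pr : probability Om R) (XT ThT TT : Type) (L K Q : nat)
    (x : 'I_L -> XT) (s : 'I_K -> ThT) (t : 'I_Q -> TT)
    (X : Om -> XT) (theta : Om -> ThT) (T : Om -> TT)
    (P : 'M[R]_(Q, L * K)) : Prop :=
  [/\ forall j c, 0 <= P j c,
      forall c, \sum_j P j c = 1
    & forall j l k, joint_pmf Pr x s X theta l k != 0 ->
        P j (mxvec_index l k) =
        fine (Pr [set w | T w = t j /\ (X w = x l /\ theta w = s k)]) /
        joint_pmf Pr x s X theta l k].

Definition del_last (R : Type) (q m : nat) (A : 'M[R]_(q.+1, m)) :
    'M[R]_(q, m) := row' ord_max A.

(* diag(v) - v v', the covariance matrix of one multinomial trial. *)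
Definition multinomial_cov (R : realType) (q : nat) (v : 'cV[R]_q) : 'M[R]_q :=
  diag_mx v^T - v *m v^T.

(* Proportions of the n observations Ts 0, ..., Ts (n - 1) equal to t_j. *)
Definition emp_freq (R : realType) (Om : Type) (TT : eqType) (Q : nat)
    (t : 'I_Q -> TT) (Ts : nat -> Om -> TT) (n : nat) (w : Om) : 'cV[R]_Q :=
  \col_j (#|[pred i : 'I_n | Ts i w == t j]|%:R / n%:R).

(* The constraints on gamma when fhat is the vector of the n-sample frequencies
   and c the critical value. The empirical covariance matrix of the indicators
   of t_1, ..., t_q, with normalization 1/n, is multinomial_cov applied to the
   frequencies. If it is singular, invmx has a default value. *)
Definition feasible (R : realType) (L K q : nat) (P : 'M[R]_(q.+1, L * K))
    (c : R) (n : nat) (fhat : 'cV[R]_(q.+1)) : set 'M[R]_(L, K) :=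
  [set gamma |
    let r := del_last fhat - del_last P *m (mxvec gamma)^T in
    [/\ n%:R * (r^T *m invmx (multinomial_cov (del_last fhat)) *m r) 0 0 < c,
        forall l k, 0 <= gamma l k <= 1
      & \sum_l \sum_k gamma l k = 1]].

Definition lin_obj (R : realType) (L K : nat) (H gamma : 'M[R]_(L, K)) : R :=
  \sum_l \sum_k H l k * gamma l k.

(* The constraint set is not closed, so the extrema are taken in the extended
   reals; over an empty set the interval [T_lower, T_upper] is empty. *)
Definition T_upper (R : realType) (L K : nat) (H : 'M[R]_(L, K))
    (F : set 'M[R]_(L, K)) : \bar R :=
  ereal_sup [set (lin_obj H gamma)%:E | gamma in F].

Definition T_lower (R : realType) (L K : nat) (H : 'M[R]_(L, K))
    (F : set 'M[R]_(L, K)) : \bar R :=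
  ereal_inf [set (lin_obj H gamma)%:E | gamma in F].

(* Main.v *)
(** With [f] the law of one observation and [S_n] the sum of the centered
    steps [(e_i - f) / sqrt n] along the sample, Pearson's statistic
    [n * sum_j (fhat_j - f_j)^2 / f_j] is [|S_n|^2] for the norm with weights
    [1 / f_j]. In that norm a step has identity covariance on the hyperplane
    [sum_j z_j = 0], so averaging [exp (- l |z|^2)] over one step gives
    [(1 + 2 l / n)^(- q / 2) * exp (- l / (1 + 2 l / n) * |z|^2)] up to
    [O(n^(- 3 / 2))] uniformly in [z]. The map [1 / l |-> 1 / l + 2 / n]
    composes exactly, hence [n] steps send the Laplace transform at [k] to
    [(1 + 2 k)^(- q / 2)], that of the chi-square law. Polynomials in
    [exp (- mu x)] close to a step function then bound the probability that
    Pearson's statistic is below [a] from below by the chi-square mass of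
    [(-oo, b]], for every [b < a]. Finally the inverse of [diag v - v v'] is
    explicit, which identifies the quadratic form of the constraint with
    Pearson's statistic, up to observed masses in the denominators; when the
    constraint holds at the true [g], both bounds enclose [T]. *)
Require Import Defs.
From HB Require Import structures.
From mathcomp Require Import all_boot all_order all_algebra.
From mathcomp Require Import all_classical all_reals all_analysis.
From mathcomp Require Import measurable_realfun.
From mathcomp Require Import ring lra.
Import Order.TTheory GRing.Theory Num.Theory.
Import numFieldNormedType.Exports.
Local Open Scope classical_set_scope.
Local Open Scope ring_scope.

Set Implicit Arguments.
Unset Strict Implicit.
Unset Printing Implicit Defensive.

(** * Elementary bounds on the exponential and the logarithm *)

Section ExpBounds.
Variable R : realType.
Implicit Types x u : R.

Lemma mvt_at0 (f df : R -> R) x : (forall u, is_derive u 1 f (df u)) ->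
  f 0 = 0 -> exists2 c, `|c| <= `|x| & f x = df c * x.
Proof.
move=> fdf f0.
have fc (A : set R) : {within A, continuous f}.
  apply: continuous_subspaceT => u; apply: differentiable_continuous.
  exact/derivable1_diffP/ex_derive.
have [x0|x0] := leP 0 x.
  have [c cx] := MVT_segment x0 (fun u _ => fdf u) (fc _).
  rewrite f0 !subr0 => ->; exists c => //.
  by move: cx; rewrite in_itv /= => /andP[c0 cx]; rewrite !ger0_norm.
have [c cx] := MVT_segment (ltW x0) (fun u _ => fdf u) (fc _).
rewrite f0 !sub0r mulrN => /oppr_inj ->; exists c => //.
move: cx; rewrite in_itv /= => /andP[cx c0].
by rewrite !ler0_norm // ?lerN2 // ltW.
Qed.

(** Each Taylor remainder of [expR] is the derivative of the next, so this climbs one order at a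
    time; the bound passes to the intermediate point because it increases with the absolute
    value. *)
Lemma mvt_expR_bound (f df : R -> R) n x :
  (forall u, is_derive u 1 f (df u)) -> f 0 = 0 ->
  (forall u, `|df u| <= `|u| ^+ n * expR `|u|) ->
  `|f x| <= `|x| ^+ n.+1 * expR `|x|.
Proof.
move=> fdf f0 dfb; have [c cx ->] := mvt_at0 x fdf f0.
rewrite normrM exprSr mulrAC ler_wpM2r // (le_trans (dfb c)) //.
apply: ler_pM; rewrite ?exprn_ge0 ?expR_ge0 ?ler_expR //.
by rewrite lerXn2r ?nnegrE.
Qed.

Lemma expR_taylor1 x : `|expR x - 1 - x| <= `|x| ^+ 2 * expR `|x|.
Proof.
apply: (@mvt_expR_bound (fun u => expR u - 1 - u) (fun u => expR u - 1)).
- move=> u; have /= := is_deriveB (is_deriveB (is_derive_expR u)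
    (is_derive_cst (1 : R) u 1)) (is_derive_id u 1); rewrite subr0; exact.
- by rewrite expR0 !subrr.
move=> u; apply: (@mvt_expR_bound (fun u => expR u - 1) expR 0).
- move=> v; have /= := is_deriveB (is_derive_expR v)
    (is_derive_cst (1 : R) v 1); rewrite subr0; exact.
- by rewrite expR0 subrr.
- by move=> v; rewrite expr0 mul1r ger0_norm ?expR_ge0 // ler_expR ler_norm.
Qed.

Lemma expR_taylor2 x :
  `|expR x - 1 - x - x ^+ 2 / 2| <= `|x| ^+ 3 * expR `|x|.
Proof.
apply: (@mvt_expR_bound (fun u => expR u - 1 - u - u ^+ 2 / 2)
  (fun u => expR u - 1 - u)).
- move=> u; apply: is_derive_eq.
  rewrite /= !scaler0 add0r /GRing.scale /=; lra.
- by rewrite expR0 expr0n /= mul0r !subrr.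
- exact: expR_taylor1.
Qed.

(** The inequality [y <= expR y] at [y = x / 4], raised to the fourth power; 256 is 4^4. *)
Lemma expR_ge_pow4 x : 0 <= x -> x ^+ 4 <= 256 * expR x.
Proof.
move=> x0; have h : x / 4 <= expR (x / 4).
  by apply: (le_trans _ (expR_ge1Dx _)); lra.
have -> : expR x = expR (x / 4) ^+ 4.
  by rewrite -expRM_natl; congr expR; field.
have -> : x ^+ 4 = 256 * (x / 4) ^+ 4 by field.
by rewrite ler_wpM2l // lerXn2r ?nnegrE ?expR_ge0 ?divr_ge0.
Qed.

(** The lower bound is [ln (1 + y) <= y] at [y = - x / (1 + x)], for which [1 + y] is the inverse of
    [1 + x], combined with [x - x ^+ 2 <= x / (1 + x)]. *)
Lemma ln1D_bound x : 0 <= x -> x - x ^+ 2 <= ln (1 + x) <= x.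
Proof.
move=> x0; have x1 : 0 < 1 + x by lra.
rewrite le_ln1Dx ?andbT; last by lra.
have h : - 1 < - (x / (1 + x)).
  by rewrite ltrN2 ltr_pdivrMr //; lra.
have := le_ln1Dx h.
have -> : 1 + - (x / (1 + x)) = (1 + x)^-1 by field; rewrite gt_eqF.
rewrite lnV ?posrE // lerN2; apply: le_trans.
rewrite ler_pdivlMr //.
have : 0 <= x ^+ 3 by rewrite exprn_ge0.
rewrite !exprS expr0; nra.
Qed.

End ExpBounds.

(** * Averaging a Gaussian over one step, reduced to scalars *)

Section OneStep.
Variable R : realType.
Implicit Types (k l r e B M u v x : R).

(** Here [e] is the step size and [M] carries the dependence on the position: the cube of [e] is
    split off from a factor that Gaussian decay can absorb. *)
Lemma taylor2_le v e M : 0 <= e <= 1 -> 0 <= M -> `|v| <= e * M ->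
  `|expR v - (1 + v + v ^+ 2 / 2)| <= e ^+ 3 * (M ^+ 3 * expR M).
Proof.
move=> /andP[e0 e1] M0 vM.
have -> : expR v - (1 + v + v ^+ 2 / 2) = expR v - 1 - v - v ^+ 2 / 2 by ring.
apply: (le_trans (expR_taylor2 v)); rewrite mulrA -exprMn.
apply: ler_pM; rewrite ?exprn_ge0 ?expR_ge0 ?ler_expR //.
  by rewrite lerXn2r ?nnegrE ?mulr_ge0.
by apply: (le_trans vM); rewrite ler_piMl.
Qed.

(** Since [u] is already of order [e ^+ 2], the first-order remainder is of order [e ^+ 4], weakened
    to [e ^+ 3]. *)
Lemma taylor1_le u e M : 0 <= e <= 1 -> 0 <= M -> `|u| <= e ^+ 2 * M ^+ 2 ->
  `|expR u - 1 - u| <= e ^+ 3 * (M ^+ 4 * expR `|u|).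
Proof.
move=> /andP[e0 e1] M0 uM.
apply: (le_trans (expR_taylor1 u)); rewrite mulrA ler_wpM2r ?expR_ge0 //.
apply: (@le_trans _ _ ((e ^+ 2 * M ^+ 2) ^+ 2)).
  by rewrite lerXn2r ?nnegrE ?mulr_ge0 ?exprn_ge0.
rewrite exprMn -!exprM ler_wpM2r ?exprn_ge0 //.
by rewrite -[(2 * 2)%N]/(3.+1) exprS ler_piMl ?exprn_ge0.
Qed.

(** Completing the square. Remainders that grow exponentially in the position [r] thus stay bounded,
    uniformly in [r], once multiplied by [expR (- kap * r ^+ 2)]. *)
Lemma gaussian_beats_linear B kap r : 0 < kap ->
  2 * (B * (1 + r)) - kap * r ^+ 2 <= 2 * B + B ^+ 2 / kap.
Proof.
move=> k0; rewrite -subr_ge0.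
have -> : 2 * B + B ^+ 2 / kap - (2 * (B * (1 + r)) - kap * r ^+ 2) =
  (kap * r - B) ^+ 2 / kap by field; rewrite gt_eqF.
by rewrite divr_ge0 ?sqr_ge0 // ltW.
Qed.

(* The exponent of the exact Gaussian smoothing of [exp (- l r^2)],
   relative to [- l r^2]. *)
Definition heat_exponent (qr l r x : R) : R :=
  l * r ^+ 2 * (x / (1 + x)) - qr / 2 * ln (1 + x).

(** Both [x / (1 + x)] and [ln (1 + x)] lie between [x - x ^+ 2] and [x]. *)
Lemma heat_exponent_bound qr l r x : 0 <= qr -> 0 <= l -> 0 <= x ->
  `|heat_exponent qr l r x| <= qr / 2 * x + l * r ^+ 2 * (x / (1 + x)) /\
  `|heat_exponent qr l r x - (l * r ^+ 2 * x - qr / 2 * x)|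
    <= (l * r ^+ 2 + qr / 2) * x ^+ 2.
Proof.
move=> qr0 l0 x0; rewrite /heat_exponent.
have /andP[h1 h2] := ln1D_bound x0.
have h3 : 0 <= ln (1 + x) by rewrite ln_ge0 // lerDl.
have x1 : 0 < 1 + x by lra.
have h4 : 0 <= x / (1 + x) by rewrite divr_ge0 // ltW.
have h5 : x - x ^+ 2 <= x / (1 + x).
  rewrite ler_pdivlMr //; have : 0 <= x ^+ 3 by rewrite exprn_ge0.
  by rewrite !exprS expr0; nra.
have h6 : x / (1 + x) <= x by rewrite ler_pdivrMr //; nra.
have h7 : 0 <= l * r ^+ 2 by rewrite mulr_ge0 ?sqr_ge0.
split; rewrite ler_norml; apply/andP; split; nra.
Qed.

Section Scalar.
(** Scalars of a random step taken from a vector z: [r] is the norm of z, [a i] the inner product of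
    z with step i, [b i] the squared norm of that step. [Ea] expresses centering, [Ea2] identity
    covariance in the direction of z, and [Eb] that the covariance has trace [qr]. *)
Variables (I : finType) (p a b : I -> R) (qr A k0 k r : R).
Hypotheses (p_ge0 : forall i, 0 <= p i) (p1 : \sum_i p i = 1).
Hypotheses (qr0 : 0 <= qr) (A0 : 0 <= A) (r0 : 0 <= r) (k00 : 0 < k0).
Hypotheses (aM : forall i, `|a i| <= A * r) (bM : forall i, 0 <= b i <= A).
Hypotheses (Ea : \sum_i p i * a i = 0) (Ea2 : \sum_i p i * a i ^+ 2 = r ^+ 2).
Hypothesis Eb : \sum_i p i * b i = qr.

(** [B] is large enough that [e * M] dominates the random exponent of a step and [e ^+ 2 * M ^+ 2]
    the heat exponent; [kap] is a lower bound for the decay rate left after smoothing. *)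
Let B := 1 + qr * k + 2 * k + 2 * k * A.
Let M := B * (1 + r).
Let kap := k0 / (1 + 2 * k).

(** It depends neither on the position [r], nor on [e], nor on [l] within [[k0, k]], so one constant
    serves every step of a walk. *)
Definition one_step_const :=
  256 * (3 + expR (qr * k)) * expR (2 * B + B ^+ 2 / kap).

Lemma weighted_le (c : I -> R) (D : R) :
  (forall i, `|c i| <= D) -> `|\sum_i p i * c i| <= D.
Proof.
move=> cD; apply: (le_trans (ler_norm_sum _ _ _)).
rewrite -[D]mul1r -p1 mulr_suml; apply: ler_sum => i _.
by rewrite normrM ger0_norm // ler_wpM2l.
Qed.

Section Fixed.
Variables l e : R.
Hypotheses (lk : k0 <= l <= k) (e01 : 0 <= e <= 1).

Let v i := - l * (2 * e * a i + e ^+ 2 * b i).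
Let x := 2 * l * e ^+ 2.
Let main := 1 + (l * r ^+ 2 * x - qr / 2 * x).

Let l0 : 0 <= l. Proof. by case/andP: lk => h _; apply: le_trans h;
  exact: ltW. Qed.
Let kk0 : 0 <= k. Proof. by case/andP: lk => _; apply: le_trans. Qed.
Let e0 : 0 <= e. Proof. by case/andP: e01. Qed.
Let x0 : 0 <= x. Proof. by rewrite !mulr_ge0 // exprn_ge0. Qed.
Let qk0 : 0 <= qr * k. Proof. exact: mulr_ge0. Qed.
Let kA0 : 0 <= k * A. Proof. exact: mulr_ge0. Qed.
Let B1 : 1 <= B.
Proof. move: qk0 kA0 kk0; rewrite /B; lra. Qed.
Let M1 : 1 <= M.
Proof. by rewrite /M mulr_ege1 // lerDl. Qed.
Let M0 : 0 <= M. Proof. exact: le_trans M1. Qed.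
Let e2e : e ^+ 2 <= e.
Proof. by case/andP: e01 => _ e1; rewrite expr2 ler_piMl. Qed.

Lemma step_exponent_le i : `|v i| <= e * M.
Proof.
have [/andP[_ lk'] /andP[b0 bA]] := (lk, bM i).
rewrite /v mulNr normrN normrM (ger0_norm l0).
have h : `|2 * e * a i + e ^+ 2 * b i| <= e * (2 * (A * r) + A).
  apply: (le_trans (ler_normD _ _)).
  have e20 : 0 <= e ^+ 2 by rewrite exprn_ge0.
  rewrite 2!normrM (ger0_norm (mulr_ge0 e20 b0)) (ger0_norm (ler0n _ 2)).
  rewrite (ger0_norm e0) mulrDr lerD //.
    by rewrite -mulrA mulrCA ler_wpM2l // ler_wpM2l.
  by apply: ler_pM.
apply: (le_trans (ler_pM l0 (normr_ge0 _) lk' h)); rewrite mulrCA ler_wpM2l //.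
rewrite /M /B; have kAr : 0 <= k * A * r by rewrite mulr_ge0.
have : 0 <= (1 + qr * k + 2 * k) * (1 + r).
  by rewrite mulr_ge0 ?addr_ge0 ?mulr_ge0.
move: kA0; lra.
Qed.

(** Order [e] cancels by [Ea], and order [e ^+ 2] gives exactly [main] by [Ea2] and [Eb]. What is
    left are the products of [a i] and [b i] and the squares of [b i], which carry at least
    [e ^+ 3]. *)
Lemma step_second_order :
  `|\sum_i p i * (1 + v i + v i ^+ 2 / 2) - main| <= e ^+ 3 * M ^+ 3.
Proof.
have [/andP[_ lk'] /andP[_ e1]] := (lk, e01).
have -> : \sum_i p i * (1 + v i + v i ^+ 2 / 2) - main =
  \sum_i p i * (2 * l ^+ 2 * e ^+ 3 * a i * b i
    + l ^+ 2 * e ^+ 4 * b i ^+ 2 / 2).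
  rewrite /main /x -Eb -{1}Ea2.
  have -> : 1 + (l * (\sum_i p i * a i ^+ 2) * (2 * l * e ^+ 2) -
     (\sum_i p i * b i) / 2 * (2 * l * e ^+ 2)) =
     \sum_i p i + (- l * 2 * e) * (\sum_i p i * a i) +
     2 * l ^+ 2 * e ^+ 2 * (\sum_i p i * a i ^+ 2)
     - l * e ^+ 2 * (\sum_i p i * b i) by rewrite Ea p1; field.
  rewrite !mulr_sumr -!big_split -!sumrN -!big_split -sumrB /=;
    apply: eq_bigr => i _.
  by rewrite /v; field.
apply: weighted_le => i; have /andP[b0 bA] := bM i.
have -> : 2 * l ^+ 2 * e ^+ 3 * a i * b i + l ^+ 2 * e ^+ 4 * b i ^+ 2 / 2 =
  e ^+ 3 * (l ^+ 2 * (2 * a i * b i + e * b i ^+ 2 / 2)) by field.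
rewrite normrM (ger0_norm (exprn_ge0 3 e0)) ler_wpM2l ?exprn_ge0 //.
rewrite normrM (ger0_norm (exprn_ge0 2 l0)).
have h : `|2 * a i * b i + e * b i ^+ 2 / 2| <= A ^+ 2 * (2 * r + 1).
  apply: (le_trans (ler_normD _ _)).
  have h1 : `|2 * a i * b i| <= 2 * (A * r) * A.
    rewrite !normrM (ger0_norm b0) (ger0_norm (ler0n _ 2)) -!mulrA.
    by rewrite ler_wpM2l // mulrA; apply: ler_pM.
  have h2 : `|e * b i ^+ 2 / 2| <= A ^+ 2.
    rewrite ger0_norm ?mulr_ge0 ?exprn_ge0 //.
    have : b i ^+ 2 <= A ^+ 2 by rewrite lerXn2r ?nnegrE.
    have : 0 <= b i ^+ 2 by rewrite exprn_ge0.
    nra.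
  nra.
apply: (@le_trans _ _ (k ^+ 2 * (A ^+ 2 * (2 * r + 1)))).
  by apply: ler_pM; rewrite ?exprn_ge0 // lerXn2r ?nnegrE.
apply: (@le_trans _ _ (M ^+ 2));
  last by rewrite [leRHS]exprS ler_peMl ?exprn_ge0.
have h3 : (2 * k * A * (1 + r)) ^+ 2 <= M ^+ 2.
  have kAB : 2 * k * A <= B by move: kA0 kk0 qk0; rewrite /B; lra.
  have r10 : 0 <= 1 + r by rewrite addr_ge0.
  rewrite lerXn2r ?nnegrE //; first by rewrite !mulr_ge0.
  by rewrite /M ler_wpM2r.
apply: le_trans h3; rewrite -subr_ge0.
have -> : (2 * k * A * (1 + r)) ^+ 2 - k ^+ 2 * (A ^+ 2 * (2 * r + 1)) =
  (k * A) ^+ 2 * (3 + 6 * r + 4 * r ^+ 2) by ring.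
by rewrite mulr_ge0 ?exprn_ge0 // !addr_ge0 ?mulr_ge0 ?exprn_ge0.
Qed.

(** The exact Gaussian smoothing has the same second-order expansion [main] as the averaged step, so
    the two can be compared through [main]. *)
Lemma heat_exponent_small :
  `|heat_exponent qr l r x| <= e ^+ 2 * M ^+ 2 /\
  `|1 + heat_exponent qr l r x - main| <= e ^+ 3 * M ^+ 4.
Proof.
have [/andP[_ lk'] /andP[_ e1]] := (lk, e01).
have [h1 h2] := heat_exponent_bound r qr0 l0 x0.
have r2 : 0 <= r ^+ 2 by rewrite exprn_ge0.
have e20 : 0 <= e ^+ 2 by rewrite exprn_ge0.
have l2k : l ^+ 2 <= k ^+ 2 by rewrite lerXn2r ?nnegrE.
have lr2 : 0 <= l * r ^+ 2 by rewrite mulr_ge0.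
have B2 : qr * k + 2 * k ^+ 2 <= B ^+ 2.
  apply: (@le_trans _ _ ((1 + qr * k + 2 * k) ^+ 2)).
    have := exprn_ge0 2 kk0; have := exprn_ge0 2 qk0.
    have := mulr_ge0 qk0 kk0; move: qk0 kk0; nra.
  rewrite lerXn2r ?nnegrE //; move: qk0 kA0 kk0; rewrite /B; lra.
have hM : qr * k + 2 * k ^+ 2 * r ^+ 2 <= M ^+ 2.
  rewrite /M exprMn; apply: (le_trans _ (ler_wpM2r _ B2)); last first.
    by rewrite exprn_ge0 // addr_ge0.
  rewrite -subr_ge0.
  have -> : (qr * k + 2 * k ^+ 2) * (1 + r) ^+ 2 -
    (qr * k + 2 * k ^+ 2 * r ^+ 2) =
    qr * k * (2 * r + r ^+ 2) + k ^+ 2 * (2 + 4 * r) by ring.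
  by rewrite addr_ge0 // mulr_ge0 ?addr_ge0 ?mulr_ge0 ?exprn_ge0.
split.
  apply: (le_trans h1).
  apply: (@le_trans _ _ (e ^+ 2 * (qr * k + 2 * k ^+ 2 * r ^+ 2))).
    have hx : x / (1 + x) <= x.
      by rewrite ler_pdivrMr ?ltr_wpDr // ler_peMr // lerDl.
    apply: (@le_trans _ _ (qr / 2 * x + l * r ^+ 2 * x)).
      by rewrite lerD2l ler_wpM2l.
    rewrite /x; have -> : qr / 2 * (2 * l * e ^+ 2)
      + l * r ^+ 2 * (2 * l * e ^+ 2)
      = e ^+ 2 * (qr * l + 2 * l ^+ 2 * r ^+ 2) by field.
    rewrite ler_wpM2l // lerD ?ler_wpM2l // ler_wpM2r // ler_wpM2l //.
  exact: ler_wpM2l.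
have -> : 1 + heat_exponent qr l r x - main =
   heat_exponent qr l r x - (l * r ^+ 2 * x - qr / 2 * x) by rewrite /main;
     ring.
apply: (le_trans h2).
apply: (@le_trans _ _ (e ^+ 4 * ((qr * k + 2 * k ^+ 2 * r ^+ 2) * (2 * k)))).
  rewrite /x; have -> : (l * r ^+ 2 + qr / 2) * (2 * l * e ^+ 2) ^+ 2 =
    e ^+ 4 * ((qr * l + 2 * l ^+ 2 * r ^+ 2) * (2 * l)) by field.
  rewrite ler_wpM2l ?exprn_ge0 //; apply: ler_pM.
  - by rewrite addr_ge0 ?mulr_ge0 ?exprn_ge0.
  - by rewrite mulr_ge0.
  - by rewrite lerD ?ler_wpM2l // ler_wpM2r // ler_wpM2l.
  - by rewrite ler_wpM2l.
apply: ler_pM.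
- by rewrite exprn_ge0.
- by rewrite !mulr_ge0 ?addr_ge0 ?mulr_ge0 ?exprn_ge0.
- by rewrite exprS ler_piMl ?exprn_ge0.
apply: (@le_trans _ _ (M ^+ 2 * M)).
  apply: ler_pM => //; first by rewrite addr_ge0 ?mulr_ge0 ?exprn_ge0.
    by rewrite mulr_ge0.
  rewrite /M; apply: (@le_trans _ _ B); first by move: qk0 kA0 kk0;
    rewrite /B; lra.
  by rewrite ler_peMr ?lerDl // (le_trans _ B1).
by rewrite -exprSr [leRHS]exprS ler_peMl ?exprn_ge0.
Qed.

Lemma one_step_scalar :
  `|\sum_i p i * expR (- l * (r ^+ 2 + 2 * e * a i + e ^+ 2 * b i))
    - expR (- (qr / 2) * ln (1 + 2 * l * e ^+ 2)
            - l / (1 + 2 * l * e ^+ 2) * r ^+ 2)| <= one_step_const * e ^+ 3.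
Proof.
have [/andP[kl lk'] /andP[_ e1]] := (lk, e01).
set u := heat_exponent qr l r x.
have x1 : 0 < 1 + x by rewrite ltr_wpDr.
have [uM umain] := heat_exponent_small.
have [ub _] := heat_exponent_bound r qr0 l0 x0.
have k10 : 0 < 1 + 2 * k by rewrite ltr_wpDr // mulr_ge0.
have kap0 : 0 < kap by rewrite divr_gt0.
set N := expR (- l * r ^+ 2).
have N0 : 0 <= N by exact: expR_ge0.
have -> : \sum_i p i * expR (- l * (r ^+ 2 + 2 * e * a i + e ^+ 2 * b i)) =
    N * \sum_i p i * expR (v i).
  rewrite mulr_sumr; apply: eq_bigr => i _.
  by rewrite mulrCA -expRD /v; congr (_ * expR _); ring.
have -> : expR (- (qr / 2) * ln (1 + 2 * l * e ^+ 2)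
            - l / (1 + 2 * l * e ^+ 2) * r ^+ 2) = N * expR u.
  rewrite -expRD -/x /u /heat_exponent; congr expR.
  by field; rewrite gt_eqF.
rewrite -mulrBr normrM (ger0_norm N0).
(* Four errors: the Taylor remainder of the step, its second-order average against [main], [main]
   against [1 + u], and the Taylor remainder of [expR u]. *)
have -> : \sum_i p i * expR (v i) - expR u =
  \sum_i p i * (expR (v i) - (1 + v i + v i ^+ 2 / 2)) +
  (\sum_i p i * (1 + v i + v i ^+ 2 / 2) - main) +
  - (1 + u - main) - (expR u - 1 - u).
  under [X in _ = X + _ + _ - _]eq_bigr => i _ do rewrite mulrBr.
  by rewrite sumrB; ring.
set T1 := \sum_i _; set T2 := _ - main; set T3 := 1 + u - main.
set T4 := expR u - 1 - u.
have h1 : `|T1| <= e ^+ 3 * (M ^+ 3 * expR M).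
  by apply: weighted_le => i; apply: taylor2_le => //; exact: step_exponent_le.
have h2 : `|T2| <= e ^+ 3 * M ^+ 3 := step_second_order.
have h4 : `|T4| <= e ^+ 3 * (M ^+ 4 * expR `|u|) by exact: taylor1_le.
have eM1 : 1 <= expR M by rewrite -expR0 ler_expR.
have M34 : M ^+ 3 <= M ^+ 4 by rewrite [leRHS]exprS ler_peMl ?exprn_ge0.
have M30 : 0 <= M ^+ 3 by rewrite exprn_ge0.
have M40 : 0 <= M ^+ 4 by rewrite exprn_ge0.
have e30 : 0 <= e ^+ 3 by rewrite exprn_ge0.
set F := expR (qr * k).
have F0 : 0 <= F by exact: expR_ge0.
set G := expR (- kap * r ^+ 2).
have r2 : 0 <= r ^+ 2 by rewrite exprn_ge0.
have x2k : x <= 2 * k.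
  by rewrite /x -[leRHS]mulr1; apply: ler_pM;
    rewrite ?exprn_ge0 ?mulr_ge0 ?exprn_ile1 ?ler_wpM2l.
have kapl : kap <= l / (1 + x).
  rewrite /kap; apply: ler_pM; rewrite ?invr_ge0 //; try exact: ltW.
  by rewrite lef_pV2 ?posrE // lerD2l.
have NG : N <= G.
  rewrite ler_expR !mulNr lerN2 ler_wpM2r //; apply: (le_trans kapl).
  by rewrite ler_pdivrMr // ler_peMr // lerDl.
(* The growth due to [u] only lowers the decay rate of [N] from [l] to [l / (1 + x)], still at least
   [kap]. *)
have NuG : N * expR `|u| <= F * G.
  rewrite -!expRD ler_expR.
  apply: (@le_trans _ _ (qr / 2 * x - l / (1 + x) * r ^+ 2)).
    apply: (@le_trans _ _ (- l * r ^+ 2 + (qr / 2 * x + l * r ^+ 2 * (x / (1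
      + x))))).
      by rewrite lerD2l.
    by rewrite le_eqVlt; apply/orP; left; apply/eqP; field; rewrite gt_eqF.
  rewrite mulNr lerB ?ler_wpM2r //.
  by have := ler_wpM2l qr0 x2k; nra.
apply: (@le_trans _ _ (N * (e ^+ 3 * (3 * (M ^+ 4 * expR M))
  + e ^+ 3 * (M ^+ 4 * expR `|u|)))).
  rewrite ler_wpM2l //; apply: (le_trans (ler_normB _ _)); apply: lerD => //.
  apply: (le_trans (ler_normD _ _)); rewrite normrN.
  have t12 := ler_normD T1 T2.
  have h5 : M ^+ 3 * expR M <= M ^+ 4 * expR M by rewrite ler_wpM2r ?expR_ge0.
  have h6 : M ^+ 4 <= M ^+ 4 * expR M by rewrite ler_peMr.
  have h7 := ler_wpM2l e30 h5; have h8 := ler_wpM2l e30 h6.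
  have h9 := ler_wpM2l e30 M34.
  have h3 : `|T3| <= e ^+ 3 * M ^+ 4 := umain.
  lra.
have M4e : M ^+ 4 <= 256 * expR M by exact: expR_ge_pow4.
have fin : expR M * expR M * G <= expR (2 * B + B ^+ 2 / kap).
  rewrite -!expRD ler_expR; apply: le_trans (gaussian_beats_linear B r kap0).
  by rewrite -/M; rewrite le_eqVlt; apply/orP; left; apply/eqP; ring.
have G0 : 0 <= G by exact: expR_ge0.
apply: (@le_trans _ _ (e ^+ 3 * (M ^+ 4 * (expR M * ((3 + F) * G))))).
  have -> : N * (e ^+ 3 * (3 * (M ^+ 4 * expR M))
    + e ^+ 3 * (M ^+ 4 * expR `|u|)) =
    e ^+ 3 * (M ^+ 4 * (3 * N * expR M + N * expR `|u|)) by ring.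
  rewrite ler_wpM2l // ler_wpM2l //.
  have : F * G <= expR M * (F * G) by rewrite ler_peMl // mulr_ge0.
  have : N * expR M <= G * expR M by rewrite ler_wpM2r // expR_ge0.
  lra.
rewrite mulrC ler_wpM2r // /one_step_const -/F.
apply: (@le_trans _ _ (256 * expR M * (expR M * ((3 + F) * G)))).
  by rewrite ler_wpM2r // !mulr_ge0 ?expR_ge0 ?addr_ge0.
have -> : 256 * expR M * (expR M * ((3 + F) * G)) =
  256 * (3 + F) * (expR M * expR M * G) by ring.
by rewrite ler_wpM2l // mulr_ge0 ?addr_ge0.
Qed.

End Fixed.
End Scalar.
End OneStep.

(** * The walk with centered steps and the Laplace transform of Pearson's statistic *)

Section PearsonWalk.
Variables (R : realType) (q : nat) (p : 'cV[R]_q.+1).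
Hypotheses (p_gt0 : forall j, 0 < p j 0) (p1 : \sum_j p j 0 = 1).
Implicit Types (z : 'cV[R]_q.+1) (k l e : R) (G : 'cV[R]_q.+1 -> R).

Definition pearson z : R := \sum_j z j 0 ^+ 2 / p j 0.

Definition centered_step (i : 'I_q.+1) : 'cV[R]_q.+1 := delta_mx i 0 - p.

(** The mean of [G] after n independent steps of scale [e] from [z], as a finite recursion on the
    first step. The link with a probability space is made in [Pr_letter_sum]. *)
Fixpoint walk e (n : nat) G z : R :=
  if n is n'.+1 then \sum_i p i 0 * walk e n' G (z + e *: centered_step i)
  else G z.

Let p0 j : 0 <= p j 0. Proof. exact: ltW. Qed.
Let pn0 j : p j 0 != 0. Proof. by rewrite gt_eqF. Qed.

Lemma pearson_ge0 z : 0 <= pearson z.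
Proof. by apply: sumr_ge0 => j _; rewrite divr_ge0 ?sqr_ge0. Qed.

Lemma centered_step_sum i : \sum_j centered_step i j 0 = 0.
Proof.
under eq_bigr do rewrite !mxE.
rewrite sumrB p1 (bigD1 i) //= !eqxx big1 ?addr0 ?subrr // => j ji.
by rewrite (negbTE ji).
Qed.

Lemma sum_stepD z e i : \sum_j z j 0 = 0 ->
  \sum_j (z + e *: centered_step i) j 0 = 0.
Proof.
move=> z0; under eq_bigr do rewrite mxE [X in _ + X]mxE.
by rewrite big_split /= -mulr_sumr centered_step_sum mulr0 addr0.
Qed.

Lemma sum_indic_eq (F : 'I_q.+1 -> R) i : \sum_j F j * (j == i)%:R = F i.
Proof.
rewrite (bigD1 i) //= eqxx mulr1 big1 ?addr0 // => j ji.
by rewrite (negbTE ji) mulr0.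
Qed.

Lemma pearson_step i : pearson (centered_step i) = (p i 0)^-1 - 1.
Proof.
rewrite /pearson.
under eq_bigr => j _ do
  (rewrite !mxE eqxx andbT;
   have -> : ((j == i)%:R - p j 0) ^+ 2 / p j 0 =
      ((p j 0)^-1 - 2) * (j == i)%:R + p j 0
     by case: (j == i) => /=; field; exact: pn0).
by rewrite big_split /= p1 sum_indic_eq; ring.
Qed.

(** In the cross term, the part [- p] of the step contributes minus the sum of the coordinates of
    [z], which is zero. *)
Lemma pearson_stepD z e i : \sum_j z j 0 = 0 ->
  pearson (z + e *: centered_step i) =
  pearson z + 2 * e * (z i 0 / p i 0) + e ^+ 2 * ((p i 0)^-1 - 1).
Proof.
move=> z0; rewrite -pearson_step.
have <- : \sum_j z j 0 / p j 0 * centered_step i j 0 = z i 0 / p i 0.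
  under eq_bigr => j _ do rewrite !mxE eqxx andbT mulrBr divfK //.
  by rewrite sumrB sum_indic_eq z0 subr0.
rewrite /pearson !mulr_sumr -!big_split; apply: eq_bigr => j _ /=.
by rewrite mxE [X in _ + X]mxE; field; exact: pn0.
Qed.

Definition inv_mass := \sum_j (p j 0)^-1.

Lemma inv_mass_ge i : (p i 0)^-1 <= inv_mass.
Proof.
by rewrite /inv_mass (bigD1 i) //= lerDl sumr_ge0 // => j _; rewrite invr_ge0.
Qed.

Lemma mass_le1 i : p i 0 <= 1.
Proof. by rewrite -p1 (bigD1 i) //= lerDl sumr_ge0. Qed.

(** The scalar case with a_i = z_i / p_i, b_i = 1 / p_i - 1 and [inv_mass] as common bound. The
    trace is the sum of 1 - p_i over q + 1 indices, that is q: the degrees of freedom. *)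
Lemma one_step_pearson z k0 k l e : \sum_j z j 0 = 0 -> 0 < k0 ->
  k0 <= l <= k -> 0 <= e <= 1 ->
  `|\sum_i p i 0 * expR (- l * pearson (z + e *: centered_step i))
    - expR (- (q%:R / 2) * ln (1 + 2 * l * e ^+ 2)
            - l / (1 + 2 * l * e ^+ 2) * pearson z)|
  <= one_step_const q%:R inv_mass k0 k * e ^+ 3.
Proof.
move=> z0 k00 lk e01.
have N0 := pearson_ge0 z.
have r2 : Num.sqrt (pearson z) ^+ 2 = pearson z by rewrite sqr_sqrtr.
under eq_bigr => i _ do rewrite pearson_stepD // -r2.
rewrite -[in X in expR (_ - _ * X)]r2.
apply: one_step_scalar => //.
- by apply: sumr_ge0 => j _; rewrite invr_ge0.
- move=> i.
  apply: (@le_trans _ _ ((p i 0)^-1 * Num.sqrt (pearson z))); last first.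
    by rewrite ler_wpM2r ?sqrtr_ge0 ?inv_mass_ge.
  rewrite normrM mulrC (@ger0_norm _ (p i 0)^-1) ?invr_ge0 //.
  rewrite ler_wpM2l ?invr_ge0 // -sqrtr_sqr ler_wsqrtr //.
  apply: (@le_trans _ _ (z i 0 ^+ 2 / p i 0)).
    by rewrite ler_pdivlMr // ler_piMr ?sqr_ge0 ?mass_le1.
  rewrite /pearson (bigD1 i) //= lerDl sumr_ge0 // => j _.
  by rewrite divr_ge0 ?sqr_ge0.
- move=> i; rewrite -{1}pearson_step pearson_ge0 /=.
  by rewrite lerBlDr (le_trans (inv_mass_ge i)) // lerDl.
- rewrite -[RHS]z0; apply: eq_bigr => i _.
  by rewrite mulrC divfK.
- rewrite r2; apply: eq_bigr => i _.
  by field; exact: pn0.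
- under eq_bigr => i _ do rewrite mulrBr mulr1 divff //.
  by rewrite sumrB p1 sumr_const card_ord -natr1 addrK.
Qed.

(** Induction on the first step: the other steps turn the rate [k] into [k / (1 + s)]. Since
    [s <= 2 * k], all rates stay in [[k / (1 + 2 * k), k]], so the same constant bounds each step;
    errors just add up, as neither averaging nor the prefactor [D <= 1] enlarges them. *)
Lemma walk_expR_bound k e n z : 0 < k -> 0 <= e <= 1 -> n%:R * e ^+ 2 <= 1 ->
  \sum_j z j 0 = 0 ->
  `|walk e n (fun z' => expR (- k * pearson z')) z
    - expR (- (q%:R / 2) * ln (1 + 2 * k * (n%:R * e ^+ 2))
            - k / (1 + 2 * k * (n%:R * e ^+ 2)) * pearson z)|
  <= n%:R * (one_step_const q%:R inv_mass (k / (1 + 2 * k)) k * e ^+ 3).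
Proof.
move=> k0 e01; have /andP[e0 e1] := e01.
have e20 : 0 <= e ^+ 2 by rewrite exprn_ge0.
set C := one_step_const _ _ _ _ * _.
elim: n z => [|n IH] z ne z0.
  rewrite !mul0r mulr0 addr0 ln1 mulr0 sub0r divr1 /= mulNr subrr normr0.
  by rewrite lexx.
set s := 2 * k * (n%:R * e ^+ 2).
have ne' : n%:R * e ^+ 2 <= 1.
  by apply: le_trans ne; rewrite ler_wpM2r // ler_nat.
have ne0 : 0 <= n%:R * e ^+ 2 by rewrite mulr_ge0.
have s0 : 0 <= s by rewrite !mulr_ge0 // ltW.
have s1 : 0 < 1 + s by rewrite ltr_wpDr.
have s2k : s <= 2 * k by rewrite /s -[leRHS]mulr1 ler_wpM2l // mulr_ge0 // ltW.
set l := k / (1 + s).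
have k1 : 0 < 1 + 2 * k by rewrite ltr_wpDr // mulr_ge0 // ltW.
have k00 : 0 < k / (1 + 2 * k) by rewrite divr_gt0.
have lk : k / (1 + 2 * k) <= l <= k.
  apply/andP; split.
    apply: (ler_wpM2l (ltW k0)).
    by rewrite lef_pV2 ?posrE // lerD2l.
  by rewrite /l ler_pdivrMr // ler_pMr // lerDl.
have step := one_step_pearson z0 k00 lk e01; rewrite -/C in step.
set D := expR (- (q%:R / 2) * ln (1 + s)).
have D1 : D <= 1.
  by rewrite /D -[leRHS]expR0 ler_expR mulNr oppr_le0 mulr_ge0 ?divr_ge0
    ?ln_ge0 ?lerDl.
have D0 : 0 <= D by exact: expR_ge0.
have sS : 2 * k * (n.+1%:R * e ^+ 2) = s + 2 * k * e ^+ 2.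
  by rewrite /s -natr1; ring.
have s21 : 0 < 1 + s + 2 * k * e ^+ 2.
  by rewrite ltr_wpDr // !mulr_ge0 // ltW.
(* This product rule makes the logarithms add and the rates compose without error. *)
have le1 : 1 + 2 * l * e ^+ 2 = (1 + s + 2 * k * e ^+ 2) / (1 + s).
  by rewrite /l; field; rewrite gt_eqF.
have gstep : expR (- (q%:R / 2) * ln (1 + (s + 2 * k * e ^+ 2))
            - k / (1 + (s + 2 * k * e ^+ 2)) * pearson z) =
   D * expR (- (q%:R / 2) * ln (1 + 2 * l * e ^+ 2)
            - l / (1 + 2 * l * e ^+ 2) * pearson z).
  rewrite -expRD; congr expR; rewrite le1 ln_div ?posrE // addrA /l.
  by field; rewrite !gt_eqF.
rewrite sS gstep /=.
have -> : \sum_i p i 0 * walk e n (fun z' => expR (- k * pearson z'))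
      (z + e *: centered_step i) -
    D * expR (- (q%:R / 2) * ln (1 + 2 * l * e ^+ 2) -
     l / (1 + 2 * l * e ^+ 2) * pearson z) =
  \sum_i p i 0 * (walk e n (fun z' => expR (- k * pearson z'))
      (z + e *: centered_step i) -
      D * expR (- l * pearson (z + e *: centered_step i))) +
  D * (\sum_i p i 0 * expR (- l * pearson (z + e *: centered_step i)) -
    expR (- (q%:R / 2) * ln (1 + 2 * l * e ^+ 2) -
     l / (1 + 2 * l * e ^+ 2) * pearson z)).
  under [in RHS]eq_bigr => i _ do rewrite mulrBr mulrCA.
  by rewrite sumrB -mulr_sumr; ring.
have -> : n.+1%:R * C = n%:R * C + C by rewrite -natr1 mulrDl mul1r.
apply: (le_trans (ler_normD _ _)); apply: lerD; last first.
  by rewrite normrM (ger0_norm D0) (le_trans _ step) // ler_piMl.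
apply: weighted_le => // i.
have := IH _ ne' (sum_stepD e i z0); rewrite -/s -/l.
by rewrite expRD -/D mulNr.
Qed.

(** With [e] the inverse square root of n, [n * e ^+ 2] is 1 while the n errors of order [e ^+ 3]
    total a constant over the square root of n. *)
Lemma walk_expR_cvg k : 0 < k ->
  (fun n => walk (Num.sqrt n%:R)^-1 n (fun z => expR (- k * pearson z)) 0)
    @ \oo --> expR (- (q%:R / 2) * ln (1 + 2 * k)).
Proof.
move=> k0; set C := one_step_const q%:R inv_mass (k / (1 + 2 * k)) k.
apply/cvgrPdist_le => eps eps0.
near=> n.
have n0 : (0 < n)%N by near: n; exists 1%N.
have sn1 : 1 <= Num.sqrt n%:R :> R by rewrite -[leLHS]sqrtr1 ler_wsqrtr //
  ler1n.
have sn0 : 0 < Num.sqrt n%:R :> R by rewrite sqrtr_gt0 ltr0n.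
have e01 : 0 <= (Num.sqrt n%:R : R)^-1 <= 1.
  by rewrite invr_ge0 ltW //= invf_le1.
have ne : n%:R * (Num.sqrt n%:R : R)^-1 ^+ 2 = 1.
  by rewrite exprVn sqr_sqrtr // divff // pnatr_eq0 -lt0n.
have z0 : \sum_j (0 : 'cV[R]_q.+1) j 0 = 0.
  by rewrite big1 // => j _; rewrite mxE.
have ne1 : n%:R * (Num.sqrt n%:R : R)^-1 ^+ 2 <= 1 by rewrite ne.
have := walk_expR_bound k0 e01 ne1 z0.
rewrite ne mulr1 -/C.
have -> : pearson 0 = 0.
  by rewrite /pearson big1 // => j _; rewrite mxE expr0n mul0r.
rewrite mulr0 subr0 distrC => /le_trans; apply.
rewrite [leLHS](_ : _ = C / Num.sqrt n%:R * (n%:R * (Num.sqrt n%:R)^-1 ^+ 2)).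
  rewrite ne mulr1.
  rewrite ler_pdivrMr // mulrC -ler_pdivrMr //.
  apply: (le_trans (ler_norm _)); rewrite -sqrtr_sqr ler_wsqrtr //.
  by near: n; exact: nbhs_infty_ger.
by ring.
Unshelve. all: by end_near. Qed.

End PearsonWalk.

(** * Laplace transform and null sets of the chi-square law *)

Section ChiSquare.
Variable R : realType.
Local Open Scope ereal_scope.
Notation mu := (@lebesgue_measure R).
Notation gaussian := (normal_prob (0 : R) 1).

Lemma integral_normal_prob (m s : R) (f : R -> \bar R) : s != 0%R ->
  (normal_prob m s).-integrable setT f ->
  \int[normal_prob m s]_x f x = \int[mu]_x (f x * (normal_pdf m s x)%:E).
Proof.
move=> s0 intf; have mf := measurable_int _ intf.
have dom := normal_prob_dominates m s.
rewrite -(Radon_Nikodym_change_of_variables dom) //.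
apply: ae_eq_integral => //.
- exact: emeasurable_funM.
- apply: emeasurable_funM => //; apply/measurable_EFinP.
  exact: measurable_normal_pdf.
- apply: ae_eqe_mul2l => /=.
  rewrite Radon_NikodymE //; case: cid => /= h [h1 h2 h3].
  apply: integral_ae_eq => //=.
  + by apply/measurable_EFinP; exact: measurable_normal_pdf.
  + by move=> E _ mE; rewrite -h3.
Qed.

Lemma measurable_expR_scale (k : R) :
  measurable_fun setT (fun x : measurableTypeR R => (expR (- k * x))%:E).
Proof.
by apply/measurable_EFinP/measurableT_comp => //; exact: measurable_funM.
Qed.

(** The integrand times the standard normal density is [s] times the centered normal density of
    standard deviation [s], the inverse square root of [1 + 2 * k]. *)
Lemma gaussian_laplace_sqr (k : R) : (0 <= k)%R ->
  \int[gaussian]_x (expR (- k * x ^+ 2))%:E =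
    (expR (- (2^-1) * ln (1 + 2 * k)))%:E.
Proof.
move=> k0; set s := expR (- (2^-1) * ln (1 + 2 * k)).
have k1 : (0 < 1 + 2 * k)%R by rewrite ltr_wpDr // mulr_ge0.
have s0 : (0 < s)%R by exact: expR_gt0.
have s2 : (s ^+ 2 = (1 + 2 * k)^-1)%R.
  rewrite -expRM_natl mulrA mulrN divff // mulN1r expRN lnK //.
have mf : measurable_fun setT (fun x : R => expR (- k * x ^+ 2)).
  by apply: measurableT_comp => //; apply: measurable_funM => //;
    exact: measurable_funX.
have f0 x : (0 <= expR (- k * x ^+ 2))%R by exact: expR_ge0.
have f1 x : (expR (- k * x ^+ 2) <= 1)%R.
  by rewrite -[leRHS]expR0 ler_expR mulNr oppr_le0 mulr_ge0 // sqr_ge0.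
rewrite integral_normal_prob ?oner_eq0 //; last first.
  apply/integrableP; split; first exact/measurable_EFinP.
  apply: (@le_lt_trans _ _ (\int[gaussian]_x (cst 1 x))).
    apply: ge0_le_integral => //=.
    - by do 2 apply: measurableT_comp => //.
    - by move=> x _; rewrite lee_fin ger0_norm.
  by rewrite integral_cst // mul1e [X in X < _]probability_setT ltry.
transitivity (\int[mu]_x (s%:E * (normal_pdf 0 s x)%:E)); last first.
  by rewrite integralZl ?integral_normal_pdf ?mule1 //;
    exact: integrable_normal_pdf.
apply: eq_integral => x _; rewrite -!EFinM; congr EFin.
rewrite !normal_pdfE ?oner_eq0 ?gt_eqF // /normal_fun mulrCA.
rewrite -expRD [RHS]mulrA; congr (_ * expR _)%R.
  rewrite /normal_peak -[(s ^+ 2 * _ *+ 2)%R]mulrnAr sqrtrM ?sqr_ge0 //.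
  rewrite sqrtr_sqr ger0_norm ?ltW // expr1n mul1r invfM mulrA divff ?mul1r //.
  by rewrite gt_eqF.
rewrite s2 !subr0 expr1n !mulr2n.
by field; rewrite gt_eqF.
Qed.

(** By Tonelli, each further squared normal variable contributes one factor [gaussian_laplace_sqr],
    starting from the point mass at 0. *)
Lemma chi2_laplace q (k : R) : (0 <= k)%R ->
  \int[chi2 R q]_x (expR (- k * x))%:E
  = (expR (- (q%:R / 2) * ln (1 + 2 * k)))%:E.
Proof.
move=> k0; elim: q => [|q IH] /=.
  rewrite integral_dirac //; last exact: measurable_expR_scale.
  by rewrite diracT mul1e mulr0 mul0r oppr0 mul0r.
rewrite ge0_integral_distribution; [|exact: measurable_expR_scale|]; last first.
  by move=> y; rewrite lee_fin expR_ge0.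
rewrite fubini_tonelli1; last 2 first.
- apply/measurable_EFinP/measurableT_comp => //.
  by apply: measurable_funM => //; exact: measurable_add_sqr.
- by move=> y; rewrite lee_fin expR_ge0.
transitivity (\int[chi2 R q]_x ((expR (- (2^-1) * ln (1 + 2 * k)))%:E
   * (expR (- k * x))%:E)).
  apply: eq_integral => x _; rewrite /fubini_F /= /add_sqr /=.
  under eq_integral do rewrite mulrDr expRD EFinM.
  rewrite ge0_integralZl ?gaussian_laplace_sqr //.
  - by rewrite muleC.
  - apply/measurable_EFinP/measurableT_comp => //.
    by apply: measurable_funM => //; exact: measurable_funX.
rewrite ge0_integralZl ?IH //.
- rewrite -EFinM -expRD -natr1; congr (expR _)%:E; by field.
- exact: measurable_expR_scale.
Qed.

Lemma chi2_lt0 q : chi2 R q [set x | (x < 0)%R] = 0.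
Proof.
have m0 : measurable [set x : measurableTypeR R | (x < 0)%R].
  rewrite (_ : [set x | _] = [set` `]-oo, 0%R[]); first exact: measurable_itv.
  by apply/seteqP; split=> x; rewrite /= in_itv.
elim: q => [|q IH] /=.
  by rewrite /dirac indicE memNset //= ltxx.
apply/eqP; rewrite eq_le measure_ge0 andbT.
apply: (@le_trans _ _ ((chi2 R q \x gaussian) ([set x | (x < 0)%R] `*` setT))).
  apply: le_measure; rewrite ?inE.
  - rewrite -[X in measurable X]setTI; exact: measurable_add_sqr.
  - exact: measurableX.
  - move=> [x y] /=; rewrite /add_sqr /= => h; split => //.
    by apply: le_lt_trans h; rewrite lerDl sqr_ge0.
by rewrite product_measure1E // [X in X * _]IH mul0e.
Qed.

(** Once the first summand is fixed, at most two values of the last normal variable reach [c], and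
    the normal law does not charge countable sets. The index [q.+1] matters: with no degree of
    freedom the law is an atom at 0. *)
Lemma chi2_set1 q (c : R) : chi2 R q.+1 [set c] = 0.
Proof.
rewrite /= /distribution /pushforward /= /product_measure1 /=.
apply: integral0_eq => x _ /=.
set A := xsection _ _.
have fA : countable A.
  apply: (@sub_countable _ _ _ [set Num.sqrt (c - x); - Num.sqrt (c - x)]%R).
    apply: subset_card_le => y; rewrite /A /xsection /= inE /= /add_sqr /= => h.
    have : (y ^+ 2 = Num.sqrt (c - x) ^+ 2)%R.
      have -> : (c - x = y ^+ 2)%R by rewrite -h addrC addKr.
      by rewrite sqr_sqrtr ?sqr_ge0.
    by move/eqP; rewrite eqf_sqr => /orP[] /eqP; [left|right].
  by apply/finite_set_countable; exact: finite_set2.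
move/null_content_dominatesP: (normal_prob_dominates (0 : R) 1); apply.
  apply: measurable_xsection.
  rewrite -[X in measurable X]setTI; exact: measurable_add_sqr.
exact: countable_lebesgue_measure0.
Qed.
End ChiSquare.

(** * Polynomials in a decaying exponential that approximate a step *)

Section StepPolynomial.
Variable R : realType.
Implicit Types a b t x u y : R.

Lemma expRN_le_inv x : 0 < x -> expR (- x) <= x^-1.
Proof.
move=> x0; rewrite expRN lef_pV2 ?posrE ?expR_gt0 //.
by apply: (le_trans _ (expR_ge1Dx x)); rewrite lerDr.
Qed.

Lemma onemX_le_expR u n : 0 <= u <= 1 -> (1 - u) ^+ n <= expR (- (n%:R * u)).
Proof.
move=> /andP[u0 u1]; rewrite -mulrN expRM_natl.
by rewrite lerXn2r ?nnegrE ?expR_ge0 ?subr_ge0 // expR_ge1Dx.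
Qed.

Lemma bernoulli_onemX u n : 0 <= u <= 1 -> 1 - n%:R * u <= (1 - u) ^+ n.
Proof.
move=> /andP[u0 u1]; elim: n => [|n IH]; first by rewrite mul0r subr0.
rewrite exprS; apply: (le_trans _ (ler_wpM2l _ IH)); last by rewrite subr_ge0.
rewrite -natr1; have : 0 <= n%:R * u ^+ 2 by rewrite mulr_ge0 ?sqr_ge0.
lra.
Qed.

(* The polynomial (1 - y^m)^(2^m) drops from 1 to 0 at y = 1/2 when m is large;
   mu is chosen so that expR (- mu t) = 1/2 for some t between b and a. *)
Lemma step_poly a b (del : R) : 0 < b -> b < a -> 0 < del ->
  exists (mu : R) (Q : {poly R}), 0 < mu /\ forall x, 0 <= x ->
    [/\ 0 <= Q.[expR (- mu * x)] <= 1,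
        x <= b -> Q.[expR (- mu * x)] <= del
      & a <= x -> 1 - del <= Q.[expR (- mu * x)] ].
Proof.
move=> b0 ba d0; pose t := (a + b) / 2.
have bt : b < t by rewrite /t; lra.
have ta : t < a by rewrite /t; lra.
have t0 : 0 < t := lt_trans b0 bt.
have l2 : 0 < ln 2 :> R by rewrite ln_gt0 // ltr1n.
pose mu : R := ln 2 / t.
have mu0 : 0 < mu by rewrite divr_gt0.
have mut : mu * t = ln 2 by rewrite divfK ?gt_eqF.
pose c1 := ln 2 - mu * b; pose c2 := mu * a - ln 2.
have c10 : 0 < c1 by rewrite /c1 -mut subr_gt0 ltr_pM2l.
have c20 : 0 < c2 by rewrite /c2 -mut subr_gt0 ltr_pM2l.
pose m := (Num.bound (del * c1)^-1 + Num.bound (del * c2)^-1).+1%N.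
have mbig c : 0 < c -> (del * c)^-1 <= m%:R -> (m%:R * c)^-1 <= del.
  move=> c0 h; have m0 : 0 < m%:R :> R by rewrite ltr0n.
  rewrite invf_ple ?posrE ?mulr_gt0 //.
  by rewrite -ler_pdivrMr // -invfM.
have ceil_nat r k : 0 <= r -> (Num.bound r <= k)%N -> r <= k%:R.
  by move=> r0 h; apply: ltW (lt_le_trans (archi_boundP r0) _); rewrite ler_nat.
have dc c : 0 < c -> 0 <= (del * c)^-1.
  by move=> c0; rewrite invr_ge0 mulr_ge0 // ltW.
have m1 : (m%:R * c1)^-1 <= del.
  by apply: mbig => //; apply: ceil_nat; rewrite ?dc // ltnW // ltnS leq_addr.
have m2 : (m%:R * c2)^-1 <= del.
  by apply: mbig => //; apply: ceil_nat; rewrite ?dc // ltnW // ltnS leq_addl.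
have m0 : 0 < m%:R :> R by rewrite ltr0n.
clearbody m; exists mu, ((1 - 'X^m) ^+ (2 ^ m)); split => // x x0.
rewrite !hornerE; set u := expR _ ^+ m.
have u01 : 0 <= u <= 1.
  rewrite /u exprn_ge0 ?expR_ge0 //= exprn_ile1 ?expR_ge0 //.
  by rewrite -expR0 ler_expR mulNr oppr_le0 mulr_ge0 // ltW.
have /andP[u0 u1] := u01.
(* The sign of the exponent decides: [ln 2 - mu * x] is at least [c1] when [x <= b] and at most
   [- c2] when [a <= x], so this product is either above [m * c1] or below the inverse of
   [m * c2]. *)
have pu : (2 ^ m)%:R * u = expR (m%:R * (ln 2 - mu * x)).
  by rewrite natrX -[X in X ^+ _](@lnK _ 2) ?posrE //
    -exprMn -expRD mulNr expRM_natl.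
split.
- by rewrite exprn_ge0 ?subr_ge0 //= exprn_ile1 ?subr_ge0 // gerBl.
- move=> xb; apply: (le_trans (onemX_le_expR _ u01)).
  have pu0 : 0 < (2 ^ m)%:R * u by rewrite pu expR_gt0.
  apply: (le_trans (expRN_le_inv pu0)).
  apply: le_trans m1; rewrite lef_pV2 ?posrE //; last exact: mulr_gt0.
  have mc : m%:R * c1 <= m%:R * (ln 2 - mu * x).
    by rewrite ler_pM2l // lerD2l lerN2 ler_pM2l.
  by rewrite pu; apply: (le_trans mc); apply: (le_trans _ (expR_ge1Dx _));
    rewrite lerDr.
- move=> ax; apply: (le_trans _ (bernoulli_onemX _ u01)).
  rewrite lerD2l lerN2 pu.
  have mc : m%:R * c2 <= m%:R * (mu * x - ln 2).
    by rewrite ler_pM2l // lerD2r ler_pM2l.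
  have -> : m%:R * (ln 2 - mu * x) = - (m%:R * (mu * x - ln 2)) by ring.
  apply: le_trans m2; apply: (@le_trans _ _ (expR (- (m%:R * c2)))).
    by rewrite ler_expR lerN2.
  by apply: expRN_le_inv; rewrite mulr_gt0.
Qed.

End StepPolynomial.

(** * From Laplace transforms to the distribution function *)

Section WalkLimit.
Variables (R : realType) (q : nat) (p : 'cV[R]_q.+1).
Hypotheses (p_gt0 : forall j, 0 < p j 0) (p1 : \sum_j p j 0 = 1).
Notation walk := (walk p).
Notation pearson := (pearson p).
Implicit Types (G H : 'cV[R]_q.+1 -> R).

Lemma walk_le e n G H z : (forall z, G z <= H z) -> walk e n G z <=
  walk e n H z.
Proof.
move=> GH; elim: n z => [|n IH] z //=; apply: ler_sum => i _.
by rewrite ler_pM2l.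
Qed.

Lemma walk_cst e n (c : R) z : walk e n (fun=> c) z = c.
Proof.
elim: n z => [|n IH] z //=; under eq_bigr do rewrite IH.
by rewrite -mulr_suml p1 mul1r.
Qed.

Lemma walk_sum e n (I : finType) (c : I -> R) (G : I -> 'cV[R]_q.+1 -> R) z :
  walk e n (fun z => \sum_i c i * G i z) z = \sum_i c i * walk e n (G i) z.
Proof.
elim: n z => [|n IH] z //=; under eq_bigr do rewrite IH mulr_sumr.
rewrite exchange_big; apply: eq_bigr => i _; rewrite mulr_sumr.
by apply: eq_bigr => j _; rewrite mulrCA.
Qed.

Lemma walkD_cst e n G (c : R) z :
  walk e n (fun z => G z + c) z = walk e n G z + c.
Proof.
elim: n z => [|n IH] z //=; under eq_bigr do rewrite IH mulrDr.
by rewrite big_split /= -mulr_suml p1 mul1r.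
Qed.

Lemma eq_walk e n G H z : (forall z, G z = H z) -> walk e n G z = walk e n H z.
Proof. by move=> /funext ->. Qed.

(** For [mu > 0], the chi-square integral of [Q.[expR (- mu * x)]], expanded into monomials so that
    it is also visibly the limit of the walk. *)
Definition chi2_transform (Q : {poly R}) (mu : R) : R :=
  \sum_(j < size Q) Q`_j * expR (- (q%:R / 2) * ln (1 + 2 * (mu * j%:R))).

Lemma expR_pow_scale (mu x : R) j :
  expR (- mu * x) ^+ j = expR (- (mu * j%:R) * x).
Proof. by rewrite -expRM_natl; congr expR; ring. Qed.

Lemma walk_poly_cvg (Q : {poly R}) (mu : R) : 0 < mu ->
  (fun n => walk (Num.sqrt n%:R)^-1 n (fun z => Q.[expR (- mu * pearson z)]) 0)
    @ \oo --> chi2_transform Q mu.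
Proof.
move=> mu0.
rewrite (_ : (fun n => _) = (fun n : nat => \sum_(j < size Q) Q`_j *
   walk (Num.sqrt n%:R)^-1 n (fun z => expR (- (mu * j%:R) * pearson z)) 0)).
  apply: cvg_big; first exact: add_continuous.
  move=> j _; apply: cvgMl_tmp.
  (* The constant monomial has rate 0, which [walk_expR_cvg] excludes; its average is 1 for every
     n. *)
  case: (val j) => [|i]; last first.
    by apply: walk_expR_cvg => //; rewrite mulr_gt0 // ltr0n.
  rewrite mulr0 mulr0 addr0 ln1 mulr0 expR0.
  rewrite (_ : (fun n => _) = cst 1); first exact: cvg_cst.
  apply/funext => n; rewrite -[RHS](walk_cst (Num.sqrt n%:R)^-1 n 1 0).
  by apply: eq_walk => z; rewrite oppr0 mul0r expR0.
apply/funext => n; rewrite -walk_sum; apply: eq_walk => z.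
by rewrite horner_coef; apply: eq_bigr => j _; rewrite expR_pow_scale.
Qed.

Local Open Scope ereal_scope.

Lemma integrable_expR_chi2 (k : R) : (0 <= k)%R ->
  (chi2 R q).-integrable setT (fun x => (expR (- k * x))%:E).
Proof.
move=> k0; apply/integrableP; split; first exact: measurable_expR_scale.
under eq_integral do rewrite gee0_abs ?lee_fin ?expR_ge0 //.
by rewrite chi2_laplace // ltry.
Qed.

Lemma horner_expR_sum (Q : {poly R}) (mu x : R) :
  (Q.[expR (- mu * x)])%:E =
  \sum_(j < size Q) ((Q`_j)%:E * (expR (- (mu * j%:R) * x))%:E).
Proof.
rewrite horner_coef -sumEFin.
by apply: eq_bigr => j _; rewrite expR_pow_scale.
Qed.

Lemma integrable_chi2_monomial (Q : {poly R}) (mu : R) (j : 'I_(size Q)) :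
  (0 < mu)%R -> (chi2 R q).-integrable setT
     (fun x => (Q`_j)%:E * (expR (- (mu * j%:R) * x))%:E).
Proof.
move=> mu0; apply: integrableZl => //; apply: integrable_expR_chi2.
by rewrite mulr_ge0 // ltW.
Qed.

Lemma integrable_chi2_poly (Q : {poly R}) (mu : R) : (0 < mu)%R ->
  (chi2 R q).-integrable setT (fun x => (Q.[expR (- mu * x)])%:E).
Proof.
move=> mu0; under eq_fun do rewrite horner_expR_sum.
by apply: integrable_sum => // j _; exact: integrable_chi2_monomial.
Qed.

Lemma integral_chi2_poly (Q : {poly R}) (mu : R) : (0 < mu)%R ->
  \int[chi2 R q]_x (Q.[expR (- mu * x)])%:E = (chi2_transform Q mu)%:E.
Proof.
move=> mu0; under eq_integral do rewrite horner_expR_sum.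
rewrite integral_sum //=; last first.
  by move=> j; exact: integrable_chi2_monomial.
rewrite /chi2_transform -sumEFin; apply: eq_bigr => j _.
have kj : (0 <= mu * j%:R)%R by rewrite mulr_ge0 // ltW.
by rewrite integralZl ?chi2_laplace //; exact: integrable_expR_chi2.
Qed.

(** The comparison is assumed for nonnegative [x] only; the negative half-line is null and is
    removed from both integrals. *)
Lemma chi2_le_transform (Q : {poly R}) (mu b : R) : (0 < mu)%R ->
  (forall x : R, 0 <= x -> ((x <= b)%R%:R <= Q.[expR (- mu * x)])%R)%R ->
  chi2 R q [set` `]-oo, b]] <= (chi2_transform Q mu)%:E.
Proof.
move=> mu0 bQ; rewrite -integral_chi2_poly //.
pose N : set (measurableTypeR R) := [set x | (x < 0)%R].
have mN : measurable N.
  rewrite (_ : N = [set` `]-oo, 0%R[]); first exact: measurable_itv.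
  by apply/seteqP; split=> x; rewrite /N /= in_itv.
have N0 : chi2 R q N = 0 := chi2_lt0 R q.
pose B : set (measurableTypeR R) := [set` `]-oo, b]].
have mB : measurable B by exact: measurable_itv.
rewrite (negligible_integral mN) //; last exact: integrable_chi2_poly.
rewrite -[X in X <= _](_ : \int[chi2 R q]_x (\1_B x)%:E = _); last first.
  by rewrite integral_indic // setIT.
rewrite [X in X <= _](ge0_negligible_integral mN) //; last first.
  by apply/measurable_EFinP; exact: measurable_indic.
apply: ge0_le_integral => //.
- by apply: measurableD.
- exact/measurable_EFinP/measurable_funTS.
- apply: measurable_funTS; exact: measurable_int (integrable_chi2_poly Q mu0).
move=> x [_ /negP]; rewrite -leNgt => x0; rewrite lee_fin.
apply: le_trans (bQ _ x0); rewrite indicE.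
by case: (boolP (x \in B)) => // /set_mem; rewrite /B /= in_itv /= => ->.
Qed.

Local Close Scope ereal_scope.

Lemma walk_lt_ge (a b eta : R) : 0 < b -> b < a -> 0 < eta ->
  \forall n \near \oo,
    (chi2 R q [set` `]-oo, b]] <=
     (walk (Num.sqrt n%:R)^-1 n (fun z => (pearson z < a)%R%:R) 0 + eta)%:E)%E.
Proof.
move=> b0 ba eta0; pose del := eta / 3.
have del0 : 0 < del by rewrite divr_gt0.
have [mu [Q [mu0 QP]]] := step_poly b0 ba del0.
(* [Q'] is at least 1 up to [b] and at most [2 * del] from [a] on. Lowered by [2 * del] it lies
   below the indicator of [x < a]; the third [del] in [eta] pays for the convergence. *)
pose Q' := (1 + del)%:P - Q.
have Q'E y : Q'.[y] = 1 + del - Q.[y] by rewrite /Q' !hornerE.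
have h1 := @chi2_le_transform Q' mu b mu0 _.
have /h1 h : forall x, 0 <= x -> (x <= b)%R%:R <= Q'.[expR (- mu * x)].
  move=> x x0; rewrite Q'E; have [/andP[Q0 Q1] Qb Qa] := QP x x0.
  by case: (leP x b) Qb => [xb /(_ isT)|xb _] /=; lra.
have /cvgrPdist_lt/(_ _ del0) := @walk_poly_cvg Q' mu mu0.
apply: filterS => n; rewrite ltr_norml => /andP[_ hw].
apply: (le_trans h); rewrite lee_fin -lerBlDr.
apply: (@le_trans _ _ (walk (Num.sqrt n%:R)^-1 n
   (fun z => Q'.[expR (- mu * pearson z)] + - (2 * del)) 0)).
  by rewrite walkD_cst; rewrite /del in hw *; lra.
apply: walk_le => z; rewrite Q'E.
have [/andP[Q0 Q1] _ Qa] := QP _ (pearson_ge0 p_gt0 z).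
by case: (ltP (pearson z) a) Qa => [xb _|xb /(_ isT)] /=; lra.
Qed.

End WalkLimit.

(** * A point strictly below the quantile with almost the same mass *)

Section QuantileApprox.
Variables (R : realType) (nu : probability (measurableTypeR R) R).
Local Open Scope ereal_scope.
Hypothesis nu_le0 : forall r : R, (r <= 0)%R -> nu [set` `]-oo, r]] = 0.
Hypothesis nu_set1 : forall c : R, nu [set c] = 0.

Let F (r : R) := nu [set` `]-oo, r]].

Let F_nd (r s : R) : (r <= s)%R -> F r <= F s.
Proof.
move=> rs; apply: le_measure; rewrite ?inE //.
by move=> x /=; rewrite !in_itv /= => /le_trans; apply.
Qed.

(** Without atoms, the mass of []c - e, c + e]] around the quantile [c] vanishes with [e], while
    [F (c + e) >= p]; hence [c - e] works. It is positive because [F] vanishes up to 0 and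
    [p - eta > 0]. *)
Lemma quantile_approx (p eta : R) : (0 < p < 1)%R -> (0 < eta < p)%R ->
  exists b : R, [/\ (0 < b)%R, (b < quantile nu p)%R &
     (p - eta)%:E <= nu [set` `]-oo, b]]].
Proof.
move=> /andP[p0 p1] /andP[eta0 etap].
set c := quantile nu p.
pose S : set R := [set r : R | p%:E <= F r].
(* [inf] is a genuine infimum only for a nonempty set bounded below: [F] tends to [1 > p], and, for
   [Slb], it vanishes left of 0. *)
have S0 : S !=set0.
  have : F n%:R @[n --> \oo] --> nu (\bigcup_n [set` `]-oo, n%:R]]).
    apply: nondecreasing_cvg_mu.
    - by move=> i; exact: measurable_itv.
    - by apply: bigcup_measurable => i _; exact: measurable_itv.
    move=> m n mn; apply/subsetPset => x /=; rewrite !in_itv /= => /le_trans;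
      apply.
    by rewrite ler_nat.
  have -> : \bigcup_n [set` `]-oo, (n%:R : R)]] = setT.
    apply/seteqP; split=> x // _; exists (Num.bound x) => //=.
    rewrite in_itv /=; apply: ltW; apply: (le_lt_trans (ler_norm x)).
    by apply: (lt_le_trans (archi_boundP (normr_ge0 x)));
      rewrite /Num.bound normr_id.
  rewrite probability_setT => /fine_cvgP[_].
  have p1' : (0 < 1 - p)%R by rewrite subr_gt0.
  move=> /cvgrPdist_lt/(_ _ p1') [N _ /(_ N)] /(_ (leqnn N)) /=.
  rewrite ltr_norml => /andP[_ h]; exists N%:R; rewrite /S /=.
  rewrite -[F _]fineK ?fin_num_measure //.
  by rewrite lee_fin; move: h; rewrite ltrBlDr; lra.
have Slb : has_lbound S.
  exists 0%R => r; rewrite /S /=; case: (leP 0%R r) => // /ltW r0.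
  by rewrite /F nu_le0 // lee_fin leNgt p0.
have cE : c = inf S by [].
have Fc (e : R) : (0 < e)%R -> p%:E <= F (c + e).
  move=> e0; have [r Sr rc] := inf_adherent e0 (conj S0 Slb).
  by apply: (le_trans Sr); apply: F_nd; rewrite cE ltW.
clear cE; move: c Fc => c Fc.
pose D (n : nat) : set R := [set` `]c - n.+1%:R^-1, c + n.+1%:R^-1]%R].
have : nu (D n) @[n --> \oo] --> nu (\bigcap_n D n).
  apply: nonincreasing_cvg_mu.
  - have mD : measurable (D 0%N) by exact: measurable_itv.
    by apply: (@le_lt_trans _ _ 1%E); [exact: probability_le1|exact: ltry].
  - by move=> i; exact: measurable_itv.
  - by apply: bigcapT_measurable => i; exact: measurable_itv.
  move=> m n mn; apply/subsetPset => x;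
    rewrite /D /= !in_itv /= => /andP[h1 h2].
  have h : (n.+1%:R^-1 <=
    m.+1%:R^-1 :> R)%R by rewrite lef_pV2 ?posrE // ler_nat.
  apply/andP; split; [apply: le_lt_trans h1|apply: (le_trans h2)].
    by rewrite lerD2l lerN2.
  by rewrite lerD2l.
have -> : \bigcap_n D n = [set c].
  apply/seteqP; split=> [x Dx|_ -> n _] /=; last first.
    have : (0 < n.+1%:R^-1 :> R)%R by rewrite invr_gt0.
    by rewrite /D /= in_itv /= => h; rewrite ltrBlDr ltrDl h lerDl ltW.
  apply/eqP; rewrite -subr_eq0 -normr_le0; apply/ler_addgt0Pl => e e0.
  rewrite addr0; have /(_ I) := Dx (Num.bound e^-1); rewrite /D /= in_itv /=.
  have : (((Num.bound e^-1).+1)%:R^-1 <= e)%R.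
    rewrite invf_ple ?posrE // ltW // (lt_le_trans (archi_boundP _)) //.
      by rewrite invr_ge0 ltW.
    by rewrite ler_nat.
  move=> h /andP[h1 h2]; rewrite ler_norml lerBrDr [(- e + c)%R]addrC.
  apply/andP; split; last by rewrite lerBlDl (le_trans h2) // lerD2l.
  by apply: ltW; apply: le_lt_trans h1; rewrite lerD2l lerN2.
rewrite nu_set1 => /fine_cvgP[_].
move=> /cvgrPdist_lt/(_ _ eta0) [N _ /(_ N)] /(_ (leqnn N)) /=.
rewrite sub0r normrN ger0_norm ?fine_ge0 // => DN.
set e : R := (N.+1%:R^-1)%R in DN.
have e0 : (0 < e)%R by rewrite invr_gt0.
have FU : F (c + e) <= F (c - e) + nu (D N).
  rewrite /F /D -/e.
  have -> : [set` `]-oo, (c + e)%R]] = [set` `]-oo, (c - e)%R]] `|`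
     [set` `](c - e)%R, (c + e)%R]].
    rewrite -itv_bndbnd_setU // !bnd_simp ?gerBl ?ltW //.
    by rewrite ltrBlDr -addrA ltrDl addr_gt0.
  by apply: measureU2; exact: measurable_itv.
have Fb : (p - eta)%:E <= F (c - e).
  have DNE : nu (D N) <= eta%:E.
    by rewrite -[nu (D N)]fineK; [rewrite lee_fin ltW|apply: fin_num_measure;
      exact: measurable_itv].
  rewrite EFinB leeBlDr //; apply: (le_trans (Fc _ e0)); apply: (le_trans FU).
  exact: leeD2l.
exists (c - e)%R; split => //; last by rewrite ltrBlDr ltrDl.
rewrite ltNge; apply/negP => /nu_le0 h; move: Fb; rewrite /F h.
by rewrite lee_fin leNgt subr_gt0 etap.
Qed.

End QuantileApprox.

Lemma chi2_itvNy_le0 (R : realType) q (r : R) : r <= 0 ->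
  (chi2 R q.+1 [set` `]-oo, r]] = 0)%E.
Proof.
move=> r0; apply/eqP; rewrite eq_le measure_ge0 andbT.
apply: (@le_trans _ _ (chi2 R q.+1 [set` `]-oo, 0%R]])).
  apply: le_measure; rewrite ?inE //; try exact: measurable_itv.
  by move=> x; rewrite [in X in X -> _]/= [in X in _ -> X]/= !in_itv /= =>
    /le_trans; apply.
have -> : [set` `]-oo, (0 : R)%R]] = [set x | (x < 0)%R] `|` [set 0%R].
  apply/seteqP; split => x /=; rewrite in_itv /= le_eqVlt.
    by case/orP => [/eqP|]; [right|left].
  by case=> [->|->]; rewrite ?eqxx ?orbT.
have m0 : measurable [set x : measurableTypeR R | (x < 0)%R].
  rewrite (_ : [set x | _] = [set` `]-oo, 0%R[]); first exact: measurable_itv.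
  by apply/seteqP; split=> x; rewrite /= in_itv.
apply: (le_trans (measureU2 _ _ _)) => //.
by rewrite [X in X + _]chi2_lt0 [X in _ + X]chi2_set1 adde0.
Qed.

Lemma chi2_quantile_approx (R : realType) q (p eta : R) : (0 < q)%N ->
  0 < p < 1 -> 0 < eta < p ->
  exists b : R, [/\ 0 < b, b < quantile (chi2 R q) p &
     ((p - eta)%:E <= chi2 R q [set` `]-oo, b]])%E].
Proof.
case: q => // q _.
by apply: quantile_approx => [r|c]; [exact: chi2_itvNy_le0|exact: chi2_set1].
Qed.

(** * The inverse multinomial covariance and Pearson's statistic *)

Section MultinomialCov.
Variables (R : realType) (q : nat).
Implicit Types (p r : 'cV[R]_q.+1).

Lemma sum_del_last (F : 'I_q.+1 -> R) :
  \sum_(i < q) F (lift ord_max i) = \sum_j F j - F ord_max.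
Proof. by rewrite (bigD1_ord ord_max) //= addrC addrK. Qed.

Lemma multinomial_covE (v : 'cV[R]_q) i j :
  multinomial_cov v i j = v i 0 *+ (i == j) - v i 0 * v j 0.
Proof. by rewrite !mxE big_ord1 !mxE. Qed.

(** The Sherman-Morrison inverse of diag v - v v' when v is [p] without its last mass and [p] sums
    to 1. *)
Definition multinomial_precision p : 'M[R]_q :=
  \matrix_(i, j) ((p (lift ord_max i) 0)^-1 *+ (i == j) + (p ord_max 0)^-1).

Lemma mulmx_multinomial_precision p : (forall j, p j 0 != 0) ->
  \sum_j p j 0 = 1 ->
  multinomial_cov (del_last p) *m multinomial_precision p = 1%:M.
Proof.
move=> p0 p1; apply/matrixP => i k; rewrite !mxE.
under eq_bigr => j _ do
  rewrite multinomial_covE [multinomial_precision _ _ _]mxE mulrBl !mulrDr.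
rewrite sumrB !big_split /= -!mulr_suml.
rewrite (bigD1 i) //= eqxx mulr1n big1 ?addr0; last first.
  by move=> j ji; rewrite eq_sym (negbTE ji) mulr0n mul0r.
rewrite (bigD1 i) //= eqxx mulr1n big1 ?addr0; last first.
  by move=> j ji; rewrite eq_sym (negbTE ji) mulr0n.
rewrite (bigD1 k) //= eqxx mulr1n big1 ?addr0; last first.
  by move=> j jk; rewrite (negbTE jk) mulr0n mulr0.
rewrite -mulr_sumr.
have -> : \sum_i0 (del_last p) i0 0 = 1 - p ord_max 0.
  rewrite -p1 -(sum_del_last (fun j => p j 0)).
  by apply: eq_bigr => j _; rewrite mxE.
rewrite !mxE; have := p0 ord_max; have := p0 (lift ord_max k).
case: (eqVneq i k) => [->|ik] nk nm; rewrite /= ?mulr1n ?mulr0n; field.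
  by rewrite nk nm.
by rewrite nk nm.
Qed.

(** As [r] sums to zero, its first q coordinates sum to minus the last one, so the rank-one part of
    the inverse supplies precisely the missing last term of Pearson's statistic. *)
Lemma pearson_invmx p r : (forall j, p j 0 != 0) -> \sum_j p j 0 = 1 ->
  \sum_j r j 0 = 0 ->
  ((del_last r)^T *m invmx (multinomial_cov (del_last p)) *m del_last r) 0 0
  = pearson p r.
Proof.
move=> p0 p1 r0.
have SB := mulmx_multinomial_precision p0 p1.
have [uS _] := mulmx1_unit SB.
have -> : invmx (multinomial_cov (del_last p)) = multinomial_precision p.
  by rewrite -[RHS](mulKmx uS) SB mulmx1.
rewrite !mxE.
have sr : \sum_i (del_last r) i 0 = - r ord_max 0.
  have := sum_del_last (fun j => r j 0); rewrite r0 sub0r => <-.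
  by apply: eq_bigr => j _; rewrite mxE.
have E j : ((del_last r)^T *m multinomial_precision p) 0 j =
    r (lift ord_max j) 0 / p (lift ord_max j) 0 - r ord_max 0 / p ord_max 0.
  rewrite mxE; under eq_bigr => i _ do rewrite mxE [multinomial_precision _ _
    _]mxE mulrDr.
  rewrite big_split /= -mulr_suml sr mulNr; congr (_ - _).
  rewrite (bigD1 j) //= eqxx mulr1n big1 ?addr0; last first.
    by move=> i ij; rewrite (negbTE ij) mulr0n mulr0.
  by rewrite mxE.
under eq_bigr => j _ do rewrite E mulrBl.
rewrite sumrB -mulr_sumr sr mulrN opprK /pearson (bigD1_ord ord_max) //= addrC.
congr (_ + _); last by rewrite mulrAC expr2.
by apply: eq_bigr => j _; rewrite mxE mulrAC expr2.
Qed.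

(** A zero mass produces a kernel vector: a basis vector if it is among the first q masses, the
    vector of ones if it is the last. The latter is nonzero because [0 < q]. *)
Lemma unitmx_multinomial_cov_gt0 p : (0 < q)%N -> (forall j, 0 <= p j 0) ->
  \sum_j p j 0 = 1 -> multinomial_cov (del_last p) \in unitmx ->
  forall j, 0 < p j 0.
Proof.
move=> q0 p0 p1 uS j; rewrite lt0r p0 andbT; apply/eqP => pj.
case: (unliftP ord_max j) => [i ji|jm].
  have : delta_mx 0 i *m multinomial_cov (del_last p) = 0 :> 'rV[R]_q.
    apply/rowP => k; rewrite -rowE mxE multinomial_covE !mxE -ji pj.
    by rewrite mul0rn mul0r subr0.
  move/(congr1 (mulmx^~ (invmx (multinomial_cov (del_last p))))).
  rewrite mulmxK // mul0mx => /rowP/(_ i)/eqP.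
  by rewrite !mxE !eqxx oner_eq0.
have : multinomial_cov (del_last p) *m const_mx 1 = 0 :> 'cV[R]_q.
  apply/colP => i; rewrite !mxE.
  under eq_bigr => k _ do rewrite multinomial_covE [const_mx _ _ _]mxE mulr1.
  rewrite sumrB -mulr_sumr (bigD1 i) //= eqxx mulr1n big1 ?addr0; last first.
    by move=> k ki; rewrite eq_sym (negbTE ki) mulr0n.
  have -> : \sum_k (del_last p) k 0 = 1.
    have := sum_del_last (fun j => p j 0);
      rewrite -[in p ord_max 0]jm pj p1 subr0 => <-.
    by apply: eq_bigr => k _; rewrite mxE.
  by rewrite mulr1 subrr.
move/(congr1 (mulmx (invmx (multinomial_cov (del_last p))))).
rewrite mulKmx // mulmx0 => /colP/(_ (Ordinal q0))/eqP.
by rewrite !mxE oner_eq0.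
Qed.

(* Replacing the true masses by the observed ones in the denominators of
   Pearson's statistic costs at most a factor [c / a] once [n] is large. *)
Lemma pearson_plugin p ph (a c : R) n : (forall j, 0 < p j 0) ->
  0 < a < c -> (forall j, a <= n%:R * ((1 - a / c) ^+ 2 * p j 0)) ->
  n%:R * pearson p (ph - p) < a ->
  (forall j, 0 < ph j 0) /\ n%:R * pearson ph (ph - p) < c.
Proof.
move=> p0 /andP[a0 ac] nbig Na.
have c0 : 0 < c := lt_trans a0 ac.
have n0 : 0 < n%:R :> R.
  rewrite ltr0n lt0n; apply/eqP => n0; move: (nbig ord0).
  by rewrite n0 mul0r leNgt a0.
set d := 1 - a / c in nbig.
have d0 : 0 < d by rewrite subr_gt0 ltr_pdivrMr // mul1r.
(* A single term of the statistic already bounds the deviation of [ph j 0] by [d * p j 0], and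
   [1 - d = a / c]. *)
have phb j : a / c * p j 0 <= ph j 0.
  have zb : n%:R * ((ph - p) j 0 ^+ 2 / p j 0) <= a.
    apply: le_trans (ltW Na); rewrite ler_pM2l //.
    rewrite /pearson (bigD1 j) //= lerDl sumr_ge0 // => k _.
    by rewrite divr_ge0 ?sqr_ge0 // ltW.
  have : (ph - p) j 0 ^+ 2 <= (d * p j 0) ^+ 2.
    have := le_trans zb (nbig j); rewrite ler_pM2l // ler_pdivrMr //.
    by move=> h; apply: (le_trans h); rewrite exprMn -mulrA -expr2.
  have dp : 0 <= d * p j 0 by rewrite mulr_ge0 // ltW.
  rewrite -[X in X <= _]real_normK ?num_real // ler_sqr ?nnegrE //
    ler_norml => /andP[+ _].
  by rewrite !mxE /d; lra.
have ac0 : 0 < a / c by rewrite divr_gt0.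
have ph0 j : 0 < ph j 0.
  by apply: lt_le_trans (phb j); rewrite mulr_gt0.
split => //.
have -> : c = c / a * a by rewrite divfK // gt_eqF.
apply: (@le_lt_trans _ _ (c / a * (n%:R * pearson p (ph - p)))); last first.
  by rewrite ltr_pM2l // divr_gt0.
rewrite mulrCA ler_pM2l // /pearson mulr_sumr; apply: ler_sum => j _.
rewrite mulrCA ler_wpM2l ?sqr_ge0 //.
rewrite -[c / a]invf_div -invfM lef_pV2 ?posrE // mulr_gt0 //.
Qed.

End MultinomialCov.

(** * Splitting events along a finite-valued variable *)

Section FiniteFibers.
Context {d : measure_display} {Om : measurableType d} {R : realType}.
Variables (Pr : probability Om R) (I : finType) (X : Om -> I).
Hypothesis mX : forall i, measurable [set w | X w = i].

(** The event may depend on the value of [X]; on each fiber it is a fixed event, which lets the next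
    letter of a sample be frozen. *)
Lemma fibers_cover (A : I -> set Om) :
  [set w | A (X w) w] =
  \big[setU/set0]_(k < #|I|) (A (enum_val k) `&` [set w | X w = enum_val k]).
Proof.
rewrite -bigcup_seq; apply/seteqP; split=> [w Aw|w [k _ [Ak Xk]]] /=.
  exists (enum_rank (X w)); first exact: mem_index_enum.
  by rewrite enum_rankK.
by rewrite Xk.
Qed.

Lemma measurable_fibers (A : I -> set Om) : (forall i, measurable (A i)) ->
  measurable [set w | A (X w) w].
Proof.
move=> mA; rewrite fibers_cover; apply: bigsetU_measurable => k _.
exact: measurableI.
Qed.

Lemma measure_fibers (A : I -> set Om) : (forall i, measurable (A i)) ->
  Pr [set w | A (X w) w] = (\sum_i Pr (A i `&` [set w | X w = i]))%E.
Proof.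
move=> mA; rewrite fibers_cover measure_bigsetU_ord.
- rewrite [RHS](reindex (fun k : 'I_#|I| => enum_val k)) //=.
  exact: (onW_bij _ (enum_val_bij I)).
- by move=> k; exact: measurableI.
- move=> k l _ _ [w [[_ Xk] [_ Xl]]]; apply: enum_val_inj.
  by rewrite -[LHS]Xk -[RHS]Xl.
Qed.

End FiniteFibers.

(** * The law of the sum of steps along a sample *)

Section LetterProcess.
Context {d : measure_display} {Om : measurableType d} {R : realType}.
Variables (Pr : probability Om R) (q : nat) (p : 'cV[R]_q.+1).
Variable C : nat -> Om -> 'I_q.+1.
Hypothesis mC : forall i j, measurable [set w | C i w = j].
Hypothesis indep : forall n (js : nat -> 'I_q.+1),
  Pr [set w | forall i, (i < n)%N -> C i w = js i] =
  (\prod_(i < n) p (js i) 0)%:E.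

Definition letter_sum (e : R) (n m : nat) (w : Om) : 'cV[R]_q.+1 :=
  \sum_(n <= i < m) e *: centered_step p (C i w).

Let prefix n (js : nat -> 'I_q.+1) :=
  [set w | forall i, (i < n)%N -> C i w = js i].

Let set_at (js : nat -> 'I_q.+1) n j i := if i == n then j else js i.

Lemma prefixS n js j :
  prefix n.+1 (set_at js n j) = prefix n js `&` [set w | C n w = j].
Proof.
apply/seteqP; split=> [w h|w [h hj] i].
  split=> [i ilt|]; last by rewrite /= h // /set_at eqxx.
  by rewrite h ?ltnS 1?ltnW // /set_at (ltn_eqF ilt).
by rewrite ltnS leq_eqVlt /set_at; case: eqP => [->|_ /= /h].
Qed.

Lemma measurable_prefix n js : measurable (prefix n js).
Proof.
elim: n js => [|n IH] js.
  by rewrite (_ : prefix 0 js = setT) //; apply/seteqP; split.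
rewrite (_ : prefix n.+1 js = prefix n.+1 (set_at js n (js n))).
  by rewrite prefixS; exact: measurableI.
by apply/seteqP; split=> w h i ilt; rewrite h // /set_at; case: eqP => // ->.
Qed.

Lemma Pr_prefixS n js j : Pr (prefix n.+1 (set_at js n j)) =
  (Pr (prefix n js) * (p j 0)%:E)%E.
Proof.
rewrite /prefix !indep big_ord_recr /= /set_at eqxx -EFinM; congr (_ * _)%:E.
by apply: eq_bigr => i _; rewrite (ltn_eqF (ltn_ord i)).
Qed.

Lemma letter_sum_recl e n m w :
  letter_sum e n (n + m.+1) w =
  e *: centered_step p (C n w) + letter_sum e n.+1 (n.+1 + m) w.
Proof. by rewrite /letter_sum addnS -addSn big_ltn // ltn_addr. Qed.

Lemma letter_event_recl (B : 'cV[R]_q.+1 -> bool) e n m z :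
  [set w | B (z + letter_sum e n (n + m.+1) w)] =
  [set w | [set w' | B (z + e *: centered_step p (C n w) +
                        letter_sum e n.+1 (n.+1 + m) w')] w].
Proof. by apply/seteqP; split=> w /=; rewrite letter_sum_recl addrA. Qed.

Lemma measurable_letter_sum (B : 'cV[R]_q.+1 -> bool) e n m z :
  measurable [set w | B (z + letter_sum e n (n + m) w)].
Proof.
elim: m n z => [|m IH] n z.
  rewrite (_ : [set w | _] = [set w | B z]).
    by case: (B z); [rewrite set_true|rewrite set_false].
  by apply/seteqP; split=> w /=; rewrite /letter_sum addn0 big_geq // addr0.
rewrite letter_event_recl.
exact: (measurable_fibers (mC n) (fun j => IH n.+1 (z
  + e *: centered_step p j))).
Qed.

(** Splitting on letter n lengthens the prefix by one and peels off the first step, exactly as in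
    the recursion of [walk]. Keeping a prefix in the statement makes the probabilities of prefixes
    the only form of independence required. *)
Lemma Pr_letter_sum (B : 'cV[R]_q.+1 -> bool) e n m js z :
  Pr (prefix n js `&` [set w | B (z + letter_sum e n (n + m) w)]) =
  (Pr (prefix n js) * (walk p e m (fun z => (B z)%:R) z)%:E)%E.
Proof.
elim: m n js z => [|m IH] n js z.
  rewrite (_ : [set w | _] = [set w | B z]); last first.
    by apply/seteqP; split=> w /=; rewrite /letter_sum addn0 big_geq // addr0.
  rewrite /=; case: (B z).
    by rewrite set_true setIT mule1.
  by rewrite set_false setI0 measure0 mule0.
rewrite letter_event_recl.
rewrite (_ : _ `&` _ = [set w | (prefix n js `&` [set w' |
   B (z + e *: centered_step p (C n w) + letter_sum e n.+1 (n.+1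
     + m) w')]) w]) //.
rewrite (measure_fibers Pr (mC n) (A := fun j => prefix n js `&` [set w' |
   B (z + e *: centered_step p j + letter_sum e n.+1 (n.+1 + m) w')]));
     last first.
  by move=> j; apply: measurableI;
    [exact: measurable_prefix|exact: measurable_letter_sum].
rewrite /= [Pr (prefix n js)]indep -EFinM mulr_sumr -sumEFin;
  apply: eq_bigr => j _.
by rewrite setIAC -prefixS IH Pr_prefixS [Pr (prefix n js)]indep -!EFinM mulrA.
Qed.

Lemma Pr_letter_sum0 (B : 'cV[R]_q.+1 -> bool) e n :
  Pr [set w | B (letter_sum e 0 n w)] =
  (walk p e n (fun z => (B z)%:R) 0)%:E.
Proof.
have := Pr_letter_sum B e 0 n (fun=> ord0) 0.
rewrite (_ : prefix 0 _ = setT); last by apply/seteqP; split.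
rewrite setTI probability_setT mul1e add0n => <-; congr (Pr _).
by apply/seteqP; split=> w /=; rewrite add0r.
Qed.

End LetterProcess.

(** * Finite expectations, and empirical frequencies as sums of steps *)

Lemma expectation_fin_valued d (Om : measurableType d) (R : realType)
    (Pr : probability Om R) (I : finType) (V : Om -> I) (F : I -> R) :
  (forall i, measurable [set w | V w = i]) ->
  ('E_Pr[fun w => F (V w)] = (\sum_i F i * fine (Pr [set w | V w = i]))%:E)%E.
Proof.
move=> mV; rewrite unlock.
have VE w : ((F (V w))%:E = \sum_i (F i)%:E * (\1_[set w | V w = i] w)%:E)%E.
  rewrite (bigD1 (V w)) //= big1 ?adde0 => [|i iV].
    by rewrite indicE mem_set // mule1.
  by rewrite indicE memNset ?mule0 // => Vi; rewrite /= Vi eqxx in iV.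
under eq_integral do rewrite VE.
have intV i : Pr.-integrable setT (fun w => (\1_[set w | V w = i] w)%:E).
  exact: integrable_indic.
rewrite integral_sum //; last by move=> i; exact: integrableZl.
rewrite -sumEFin; apply: eq_bigr => i _.
rewrite integralZl // integral_indic // setIT EFinM fineK //.
exact: fin_num_measure.
Qed.

(** One inverse square root of n is the step scale and the other the normalization; their product is
    the 1/n of a proportion. *)
Lemma emp_freq_letter_sum d (Om : measurableType d) (R : realType) (TT :
  eqType) q
    (t : 'I_q.+1 -> TT) (Ts : nat -> Om -> TT) (C : nat -> Om -> 'I_q.+1)
    (p : 'cV[R]_q.+1) n w :
  injective t -> (forall i w, t (C i w) = Ts i w) -> (0 < n)%N ->
  emp_freq R t Ts n w - p =
  (Num.sqrt n%:R)^-1 *: letter_sum p C (Num.sqrt n%:R)^-1 0 n w.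
Proof.
move=> t_inj tC n0; apply/matrixP => j k; rewrite [k]ord1 !mxE summxE.
rewrite big_mkord mulr_sumr.
have nn : n%:R != 0 :> R by rewrite pnatr_eq0 -lt0n.
have ss : (Num.sqrt n%:R)^-1 * (Num.sqrt n%:R)^-1 = n%:R^-1 :> R.
  by rewrite -invfM -expr2 sqr_sqrtr.
under eq_bigr => i _ do rewrite !mxE eqxx andbT mulrA ss mulrBr.
rewrite sumrB sumr_const card_ord -[_^-1 * _ *+ n]mulr_natl mulrA divff //
  mul1r; congr (_ - _).
rewrite -mulr_sumr mulrC -sum1_card natr_sum [in LHS]big_mkcond /=;
  congr (_ * _).
apply: eq_bigr => i _; rewrite inE -tC (inj_eq t_inj) eq_sym.
by case: (j == C i w).
Qed.

Lemma letter_sum_sum d (Om : measurableType d) (R : realType) q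
    (C : nat -> Om -> 'I_q.+1) (p : 'cV[R]_q.+1) e n m w :
  \sum_j p j 0 = 1 -> \sum_j letter_sum p C e n m w j 0 = 0.
Proof.
move=> p1; under eq_bigr do rewrite summxE; rewrite exchange_big big1 // => i _.
by under eq_bigr do rewrite mxE; rewrite -mulr_sumr centered_step_sum // mulr0.
Qed.

Lemma pearsonZ (R : realType) q (p : 'cV[R]_q.+1) (a : R) z :
  pearson p (a *: z) = a ^+ 2 * pearson p z.
Proof.
rewrite /pearson mulr_sumr; apply: eq_bigr => j _.
by rewrite mxE exprMn mulrA.
Qed.

Lemma limn_einf_ge (R : realType) (u : (\bar R)^nat) (a : \bar R) :
  (\forall n \near \oo, (a <= u n)%E) -> (a <= limn_einf u)%E.
Proof.
move=> [N _ Nu]; rewrite limn_einf_lim.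
apply: lime_ge; first exact: is_cvg_einfs.
exists N => // n /= Nn; apply/ereal_infP => _ [k /= nk <-].
by apply: Nu; exact: leq_trans nk.
Qed.

Lemma del_lastB (R : pzRingType) q m (A B : 'M[R]_(q.+1, m)) :
  del_last (A - B) = del_last A - del_last B.
Proof. by apply/matrixP => i j; rewrite !mxE. Qed.

Lemma del_last_mul (R : pzRingType) q m n (A : 'M[R]_(q.+1, m))
    (B : 'M[R]_(m, n)) :
  del_last A *m B = del_last (A *m B).
Proof.
by apply/matrixP => i j; rewrite !mxE; apply: eq_bigr => k _; rewrite mxE.
Qed.

(** * The law of [(X, theta)] and the identity f = P g *)

Section JointLaw.
Context {d : measure_display} {Om : measurableType d} {R : realType}.
Variables (Pr : probability Om R) (XT ThT TT : Type) (L K q : nat).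
Variables (x : 'I_L -> XT) (s : 'I_K -> ThT) (t : 'I_q.+1 -> TT).
Variables (X : Om -> XT) (theta : Om -> ThT) (V : Om -> 'I_L * 'I_K).
Hypothesis VE : forall i, [set w | V w = i] = [set w | X w =
  x i.1 /\ theta w = s i.2].
Hypothesis mV : forall i, measurable [set w | V w = i].
Notation g := (joint_pmf Pr x s X theta).

Lemma joint_pmfE i : (g i.1 i.2)%:E = Pr [set w | V w = i].
Proof. by rewrite mxE -VE fineK // fin_num_measure. Qed.

Lemma joint_pmf_bounds l k : 0 <= g l k <= 1.
Proof.
rewrite -!lee_fin (joint_pmfE (l, k)) measure_ge0 /=.
exact: probability_le1.
Qed.

Lemma joint_pmf_sum : \sum_l \sum_k g l k = 1.
Proof.
apply: EFin_inj; rewrite pair_big /= -sumEFin.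
rewrite -(@probability_setT _ _ _ Pr).
have := measure_fibers Pr mV (A := fun=> setT) (fun=> measurableT).
rewrite (_ : [set w | _] = setT) => [->|]; last by apply/seteqP; split.
apply: eq_bigr => i _.
by rewrite (joint_pmfE i) setTI.
Qed.

Lemma expectation_joint (h : XT -> ThT -> R) :
  (forall w, X w = x (V w).1 /\ theta w = s (V w).2) ->
  ('E_Pr[fun w => h (X w) (theta w)] =
   (lin_obj (\matrix_(l, k) h (x l) (s k)) g)%:E)%E.
Proof.
move=> XV; rewrite (_ : (fun w => _) = (fun w => h (x (V w).1) (s (V w).2))).
  rewrite (expectation_fin_valued Pr (fun i => h (x i.1) (s i.2)) mV).
  rewrite /lin_obj pair_big /=; congr (_%:E); apply: eq_bigr => i _.
  by rewrite -joint_pmfE !mxE.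
by apply/funext => w; have [-> ->] := XV w.
Qed.

Lemma total_probability (T : Om -> TT) (P : 'M[R]_(q.+1, L * K)) :
  (forall j, measurable [set w | T w = t j]) ->
  is_cond_dist Pr x s t X theta T P ->
  P *m (mxvec g)^T = pmf_vec Pr t T.
Proof.
move=> mT [_ _ Pg]; apply/matrixP => j k; rewrite [k]ord1 !mxE.
rewrite (reindex (fun i : 'I_L * 'I_K => mxvec_index i.1 i.2)) /=; last first.
  apply: onW_bij; have [f fK Kf] := curry_mxvec_bij L K.
  exists f => [[l m]|c]; first exact: (fK (l, m)).
  by rewrite -[RHS]Kf; case: (f c).
apply: EFin_inj; rewrite fineK ?fin_num_measure //.
rewrite (measure_fibers Pr mV (A := fun=> [set w | T w = t j])) //.
rewrite -sumEFin; apply: eq_bigr => i _; rewrite mxE mxvecE VE.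
have mI : measurable ([set w | T w = t j] `&` [set w | V w =
  i]) by exact: measurableI.
rewrite -VE -[RHS]fineK ?fin_num_measure //; congr (_%:E).
(* A pair of mass zero leaves its column of [P] unspecified, but then the joint event is null as
   well. *)
have [g0|g0] := eqVneq (g i.1 i.2) 0.
  rewrite g0 mulr0; apply/esym/eqP; rewrite -eqe fineK ?fin_num_measure //.
  rewrite eq_le measure_ge0 andbT.
  apply: (@le_trans _ _ (Pr [set w | V w = i])); last by rewrite -joint_pmfE g0.
  by apply: le_measure; rewrite ?inE.
by rewrite Pg // divfK // VE.
Qed.

End JointLaw.

(** * Asymptotic coverage, from the feasibility of the true [g] *)

Theorem theorem1 (R : realType) (d : measure_display) (Om : measurableType d)
  (Pr : probability Om R)
  (XT YT ThT : Type) (TT : eqType) (L J K q : nat)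
  (x : 'I_L -> XT) (y : 'I_J -> YT) (s : 'I_K -> ThT)
  (x_inj : injective x) (y_inj : injective y) (s_inj : injective s)
  (X : Om -> XT) (Y : Om -> YT) (theta : Om -> ThT)
  (Xs : nat -> Om -> XT) (Ys : nat -> Om -> YT) (thetas : nat -> Om -> ThT)
  (Z_discrete : discrete_rv (range x `*` range y `*` range s)
                            (fun w => (X w, Y w, theta w)))
  (Zs_discrete : forall i, discrete_rv (range x `*` range y `*` range s)
                             (fun w => (Xs i w, Ys i w, thetas i w)))
  (Zs_iid : iid_copies Pr (fun w => (X w, Y w, theta w))
                          (fun i w => (Xs i w, Ys i w, thetas i w)))
  (* the number of distinct values is Q = q + 1 >= 2 *)
  (q_gt0 : (0 < q)%N)
  (T : XT -> YT -> TT) (t : 'I_q.+1 -> TT) (t_inj : injective t)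
  (t_range : range t = [set v | exists l j, v = T (x l) (y j)])
  (P : 'M[R]_(q.+1, L * K))
  (P_cond : is_cond_dist Pr x s t X theta (fun w => T (X w) (Y w)) P)
  (h : XT -> ThT -> R)
  (alpha : R) (alpha01 : 0 < alpha < 1)
  (Sigma_nonsing :
     multinomial_cov (del_last (pmf_vec Pr t (fun w => T (X w) (Y w))))
       \in unitmx) :
  let c := quantile (chi2 R q) (1 - alpha) in
  let H := \matrix_(l < L, k < K) h (x l) (s k) in
  let fhat n w := emp_freq R t (fun i w' => T (Xs i w') (Ys i w')) n w in
  let TL n w := T_lower H (feasible P c n (fhat n w)) in
  let TU n w := T_upper H (feasible P c n (fhat n w)) in
  let ET := ('E_Pr[(fun w => h (X w) (theta w))])%E in
  ET = (lin_obj H (joint_pmf Pr x s X theta))%:E /\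
  ((1 - alpha)%:E <=
     limn_einf (fun n => Pr [set w | TL n w <= ET /\ ET <= TU n w]))%E.
Proof.
move=> c H fhat TL TU ET.
pose Z w := (X w, Y w, theta w).
pose Zs i w := (Xs i w, Ys i w, thetas i w).
pose A j : set (XT * YT * ThT) := [set z | T z.1.1 z.1.2 = t j].
pose f := pmf_vec Pr t (fun w => T (X w) (Y w)).
pose g := joint_pmf Pr x s X theta.
have [ZS mZ] := Z_discrete.
have [Zs_law Zs_indep] := Zs_iid.
have /choice[V VP] : forall w, exists v : 'I_L * 'I_K,
    X w = x v.1 /\ theta w = s v.2.
  move=> w; have [[[l _ lX] _] [k _ kT]] := ZS w.
  by exists (l, k).
have VE i : [set w | V w = i] = [set w | X w = x i.1 /\ theta w = s i.2].
  apply/seteqP; split=> w /=; first by move=> <-; exact: VP.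
  by have [-> ->] := VP w => -[/x_inj + /s_inj];
    case: (V w) i => ? ? [? ?] /= -> ->.
have mV i : measurable [set w | V w = i].
  by rewrite VE; exact: (mZ [set z | z.1.1 = x i.1 /\ z.2 = s i.2]).
have mT j : measurable [set w | T (X w) (Y w) = t j] by exact: (mZ (A j)).
(* The letter of observation i is the index of its value among the t_j; choosing over pairs [(i, w)]
   defines all letters at once. *)
have /choice[C' C'P] : forall iw : nat * Om, exists j,
    t j = T (Xs iw.1 iw.2) (Ys iw.1 iw.2).
  move=> [i w] /=; have [ZsS _] := Zs_discrete i.
  have [[[l _ lX] [j _ jY]] _] := ZsS w.
  have : range t (T (Xs i w) (Ys i w)).
    by rewrite t_range; exists l, j; rewrite lX jY.
  by case=> m _ tm; exists m.
pose C i w := C' (i, w).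
have CP i w : t (C i w) = T (Xs i w) (Ys i w) := C'P (i, w).
have CE i j : [set w | C i w = j] = Zs i @^-1` A j.
  apply/seteqP; split=> w /=; rewrite /A /= -CP; first by move=> ->.
  exact: t_inj.
have mC i j : measurable [set w | C i w = j].
  by rewrite CE; have [_ mZs] := Zs_discrete i; exact: mZs.
have PC i j : Pr [set w | C i w = j] = (f j 0)%:E.
  by rewrite CE Zs_law mxE fineK // fin_num_measure.
have indep n (js : nat -> 'I_q.+1) :
    Pr [set w | forall i, (i < n)%N -> C i w = js i] =
    (\prod_(i < n) f (js i) 0)%:E.
  have := Zs_indep (iota 0 n) (fun i => A (js i)) (iota_uniq 0 n).
  have -> : \bigcap_(i in [set` iota 0 n]) (Zs i @^-1` A (js i)) =
      [set w | forall i, (i < n)%N -> C i w = js i].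
    apply/seteqP; split=> w /= hw i.
      move=> ilt; have : (Zs i @^-1` A (js i)) w by apply: hw;
        rewrite /= mem_iota.
      by rewrite -CE.
    rewrite /= mem_iota add0n => ilt.
    have : [set w | C i w = js i] w by exact: hw.
    by rewrite CE.
  move=> ->; rewrite -[X in iota 0 X]subn0 -/(index_iota 0 n) big_mkord.
  rewrite -prodEFin; apply: eq_bigr => i _.
  by rewrite -CE PC.
have f1 : \sum_j f j 0 = 1.
  apply: EFin_inj; rewrite -sumEFin -(@probability_setT _ _ _ Pr).
  have := measure_fibers Pr (mC 0%N) (A := fun=> setT) (fun=> measurableT).
  rewrite (_ : [set w | _] = setT) => [->|]; last by apply/seteqP; split.
  by apply: eq_bigr => j _; rewrite setTI PC.
have f_ge0 j : 0 <= f j 0 by rewrite mxE fine_ge0.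
have f_gt0 := unitmx_multinomial_cov_gt0 q_gt0 f_ge0 f1 Sigma_nonsing.
have ETE : ET = (lin_obj H g)%:E := expectation_joint Pr VE mV h VP.
have Pg : P *m (mxvec g)^T = f := total_probability VE mV mT P_cond.
split=> //.
apply/lee_subgt0Pr => eta0 eta0_gt0.
have alpha1 : 0 < 1 - alpha < 1 by lra.
(* [eta] is lost twice, at the quantile and in [walk_lt_ge], hence the half of [eta0]; the other
   bound keeps [eta] below [1 - alpha]. *)
pose eta := Num.min (eta0 / 2) ((1 - alpha) / 2).
have eta_gt0 : 0 < eta by rewrite /eta lt_min !divr_gt0 //; lra.
have eta_le : eta <= eta0 / 2 by rewrite /eta ge_min lexx.
have eta_lt : 0 < eta < 1 - alpha.
  by rewrite eta_gt0 /eta gt_min; apply/orP; right; lra.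
have [b [b0 bc Fb]] := chi2_quantile_approx q_gt0 alpha1 eta_lt.
rewrite -/c in bc.
(* The gap from [b] to [a] is spent on smoothing the indicator, the gap from [a] to [c] on the
   observed masses in the denominators. *)
pose a := (b + c) / 2.
have ba : b < a by rewrite /a; lra.
have ac : a < c by rewrite /a; lra.
have a0 : 0 < a := lt_trans b0 ba.
pose D := (1 - a / c) ^+ 2.
have D0 : 0 < D.
  by rewrite exprn_gt0 // subr_gt0 ltr_pdivrMr ?mul1r // (lt_trans a0).
have Df j : 0 < D * f j 0 by apply: mulr_gt0.
apply: limn_einf_ge; near=> n.
have n0 : (0 < n)%N by near: n; exists 1%N.
have nbig j : a <= n%:R * (D * f j 0).
  rewrite -ler_pdivrMr //.
  (* The sum dominates each of its terms, so one threshold for [n] serves all [j]. *)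
  have : \sum_k a / (D * f k 0) <= n%:R by near: n; exact: nbhs_infty_ger.
  apply: le_trans; rewrite (bigD1 j) //= lerDl sumr_ge0 // => k _.
  by apply: divr_ge0; exact: ltW.
have walkn : (chi2 R q [set` `]-oo, b]] <=
     (walk f (Num.sqrt n%:R)^-1 n (fun z => (pearson f z < a)%R%:R) 0
       + eta)%:E)%E.
  by near: n; exact: walk_lt_ge.
set e := (Num.sqrt n%:R)^-1 in walkn.
have e2 : n%:R * e ^+ 2 = 1 :> R.
  by rewrite exprVn sqr_sqrtr // divff // pnatr_eq0 -lt0n.
have fhatE w : fhat n w - f = e *: letter_sum f C e 0 n w.
  by apply: emp_freq_letter_sum => // i w'; exact: CP.
pose S := letter_sum f C e 0 n.
(* Coverage depends on [w] only through [S w], a function of finitely many letters; this makes the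
   coverage event measurable, as monotonicity of [Pr] requires. *)
pose good z := `[< (T_lower H (feasible P c n (f + e *: z)) <= ET)%E /\
                   (ET <= T_upper H (feasible P c n (f + e *: z)))%E >].
have goodE : [set w | (TL n w <= ET)%E /\ (ET <=
  TU n w)%E] = [set w | good (S w)].
  apply/seteqP; split=> w; rewrite /= /TL /TU.
    by rewrite -[fhat n w](subrK f) fhatE addrC => h'; apply/asboolP.
  by move/asboolP; rewrite -fhatE addrC subrK.
have mS (B : 'cV[R]_q.+1 -> bool) : measurable [set w | B (S w)].
  have := measurable_letter_sum f mC B e 0 n 0.
  by under eq_fun do rewrite add0r.
rewrite goodE.
apply: (@le_trans _ _ (Pr [set w | pearson f (S w) < a])).
  rewrite (Pr_letter_sum0 mC indep (fun z => pearson f z < a)).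
  rewrite -EFinB lee_fin; move: (le_trans Fb walkn); rewrite lee_fin.
  by lra.
apply: le_measure; rewrite ?inE //;
  first exact: (mS (fun z => pearson f z < a)).
move=> w /= Sa; apply/asboolP; rewrite -fhatE addrC subrK.
have stat_lt : n%:R * pearson f (fhat n w - f) < a.
  by rewrite fhatE pearsonZ mulrA e2 mul1r.
have [ph_gt0 ph_lt] := pearson_plugin f_gt0 (introT andP (conj a0 ac)) nbig
  stat_lt.
have r0 : \sum_j (fhat n w - f) j 0 = 0.
  rewrite fhatE; under eq_bigr do rewrite mxE.
  by rewrite -mulr_sumr letter_sum_sum // mulr0.
have ph1 : \sum_j (fhat n w) j 0 = 1.
  rewrite -f1; apply/eqP; rewrite -subr_eq0 -sumrB; apply/eqP.
  rewrite -[RHS]r0.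
  by apply: eq_bigr => j _; rewrite !mxE.
have gF : feasible P c n (fhat n w) g.
  rewrite /feasible /=; split.
  - rewrite del_last_mul Pg -del_lastB pearson_invmx // => j.
    by rewrite gt_eqF.
  - by move=> l k; exact: (joint_pmf_bounds Pr VE mV).
  - exact: (joint_pmf_sum Pr VE mV).
(* The true [g] is feasible, so its objective value lies between the infimum and the supremum. *)
by rewrite ETE; split; [apply: ereal_inf_lbound|apply: ereal_sup_ubound];
  exists g.
Unshelve. all: by end_near.
Qed.
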